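(* Let $\mathbf{A}\in\mathbb{R}^{n\times d}$, $\mathbf{\Sigma}=\mathbf{A}^\top\mathbf{A}$ with largest eigenvalue $\lambda_1$, let $\epsilon\in(0,1)$, $\lambda=(1+\frac{\epsilon}{100})\lambda_1$ and $\mathbf{B}=\lambda\mathbf{I}-\mathbf{A}^\top\mathbf{A}$, and let $x_0\sim\mathcal{N}(0,\mathbf{I})$. Running the shifted-and-inverted power method on $\mathbf{B}$ initialized at $x_0$, using an SVRG-based linear system solver to approximately apply $\mathbf{B}^{-1}$ at each step, returns a unit vector $x$ such that with probability $1-O(1/d^{10})$, $x^\top\mathbf{\Sigma}x\ge(1-\epsilon)\lambda_1$, in time $$O\left(\left(\mathrm{nnz}(\mathbf{A})+\frac{d\,\mathrm{sr}(\mathbf{A})}{\epsilon^2}\right)\cdot\log^2\left(\frac d\epsilon\right)\right).$$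
   Context: No eigengap assumption is made. $\mathrm{nnz}(\mathbf{A})$ is the number of nonzero entries of $\mathbf{A}$; $\mathrm{sr}(\mathbf{A})=\|\mathbf{A}\|_F^2/\|\mathbf{A}\|_2^2$ is the stable rank. Runtime counts arithmetic operations with $\mathbf{A}$ given explicitly.
   Formalization: A is assumed nonzero (otherwise sr(A) is undefined), and the running-time bound is claimed only when d/ε ≥ 2 (automatic for d ≥ 2), since for d = 1 and ε near 1 the factor log²(d/ε) tends to 0 and the stated bound fails. *)

(* Defs.v *)
From HB Require Import structures.
From mathcomp Require Import all_boot all_order all_algebra.
From mathcomp Require Import all_classical all_reals all_analysis.

Set Implicit Arguments.
Unset Strict Implicit.
Unset Printing Implicit Defensive.

Import Order.TTheory GRing.Theory Num.Theory.

Local Open Scope classical_set_scope.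
Local Open Scope ring_scope.

Definition norm2 (R : realType) (d : nat) (x : 'cV[R]_d) : R :=
  Num.sqrt (\sum_i x i 0 ^+ 2).

Definition frobenius_norm (R : realType) (n d : nat) (A : 'M[R]_(n, d)) : R :=
  Num.sqrt (\sum_i \sum_j A i j ^+ 2).

Definition spectral_norm (R : realType) (n d : nat) (A : 'M[R]_(n, d)) : R :=
  sup [set norm2 (A *m x) | x in [set x : 'cV[R]_d | norm2 x = 1]].

Definition stable_rank (R : realType) (n d : nat) (A : 'M[R]_(n, d)) : R :=
  frobenius_norm A ^+ 2 / spectral_norm A ^+ 2.

Definition nnz (R : realType) (n d : nat) (A : 'M[R]_(n, d)) : nat :=
  #|[set ij : 'I_n * 'I_d | A ij.1 ij.2 != 0]%SET|.

Definition largest_eigenvalue (R : realType) (d : nat) (S : 'M[R]_d) (l : R) :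
    Prop :=
  eigenvalue S l /\ forall m, eigenvalue S m -> m <= l.

Definition quad_form (R : realType) (d : nat) (S : 'M[R]_d) (x : 'cV[R]_d) : R :=
  (x^T *m S *m x) 0 0.

Definition nat_ceil (R : realType) (a : R) : nat := `|Num.ceil a|%N.

(* Each constructor other than [Ret] is one instruction: a real operation, a
   zero test, a rounding, or a random draw.  Reading or writing an array entry
   and running a counter are not arithmetic and carry no instruction. *)

Inductive binop := Add | Sub | Mul | Div.

Definition eval_binop (R : realType) (o : binop) (a b : R) : R :=
  match o with
  | Add => a + b
  | Sub => a - b
  | Mul => a * b
  | Div => a / b
  end.

Inductive prog (R : realType) (X : Type) : Type :=
| Ret of X
| Arith of binop & R & R & (R -> prog R X)
| Sqrt of R & (R -> prog R X)
| IsZero of R & (bool -> prog R X)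
| Ceil of R & (nat -> prog R X)
| Draw (m : nat) of ('I_m -> R) & ('I_m -> prog R X)
| Gauss of (R -> prog R X).

Arguments Ret {R X}.
Arguments Arith {R X}.
Arguments Sqrt {R X}.
Arguments IsZero {R X}.
Arguments Ceil {R X}.
Arguments Draw {R X m}.
Arguments Gauss {R X}.

Fixpoint bind (R : realType) (X Y : Type) (c : prog R X) (f : X -> prog R Y) :
    prog R Y :=
  match c with
  | Ret x => f x
  | Arith o a b k => Arith o a b (fun v => bind (k v) f)
  | Sqrt a k => Sqrt a (fun v => bind (k v) f)
  | IsZero a k => IsZero a (fun v => bind (k v) f)
  | Ceil a k => Ceil a (fun v => bind (k v) f)
  | Draw _ p k => Draw p (fun i => bind (k i) f)
  | Gauss k => Gauss (fun z => bind (k z) f)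
  end.

Notation "x <-- c ;; e" := (bind c (fun x => e))
  (at level 65, c at level 64, right associativity).

(* Probability that the result lies in [Q].  Successive draws are independent:
   [Draw p] returns [i] with probability [p i], and [Gauss] samples N(0,1).
   On nonnegative integrands the library integral is a supremum over simple
   functions below, so lower bounds on [prob] presuppose no measurability. *)
Fixpoint prob (R : realType) (X : Type) (c : prog R X) (Q : set X) : \bar R :=
  match c with
  | Ret x => (\1_Q x)%:E
  | Arith o a b k => prob (k (eval_binop o a b)) Q
  | Sqrt a k => prob (k (Num.sqrt a)) Q
  | IsZero a k => prob (k (a == 0)) Q
  | Ceil a k => prob (k (nat_ceil a)) Q
  | Draw m p k => (\sum_(i < m) (p i)%:E * prob (k i) Q)%E
  | Gauss k => (\int[normal_prob (0 : R) 1]_z prob (k z) Q)%E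
  end.

Fixpoint always (R : realType) (X : Type) (c : prog R X) (Q : set X) : Prop :=
  match c with
  | Ret x => Q x
  | Arith o a b k => always (k (eval_binop o a b)) Q
  | Sqrt a k => always (k (Num.sqrt a)) Q
  | IsZero a k => always (k (a == 0)) Q
  | Ceil a k => always (k (nat_ceil a)) Q
  | Draw _ _ k => forall i, always (k i) Q
  | Gauss k => forall z, always (k z) Q
  end.

Fixpoint time_le (R : realType) (X : Type) (c : prog R X) (N : nat) : Prop :=
  match c with
  | Ret _ => True
  | Arith o a b k => (0 < N)%N /\ time_le (k (eval_binop o a b)) N.-1
  | Sqrt a k => (0 < N)%N /\ time_le (k (Num.sqrt a)) N.-1
  | IsZero a k => (0 < N)%N /\ time_le (k (a == 0)) N.-1
  | Ceil a k => (0 < N)%N /\ time_le (k (nat_ceil a)) N.-1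
  | Draw _ _ k => (0 < N)%N /\ forall i, time_le (k i) N.-1
  | Gauss k => (0 < N)%N /\ forall z, time_le (k z) N.-1
  end.

Definition addp (R : realType) (a b : R) : prog R R := Arith Add a b Ret.
Definition subp (R : realType) (a b : R) : prog R R := Arith Sub a b Ret.
Definition mulp (R : realType) (a b : R) : prog R R := Arith Mul a b Ret.
Definition divp (R : realType) (a b : R) : prog R R := Arith Div a b Ret.
Definition sqrtp (R : realType) (a : R) : prog R R := Sqrt a Ret.
Definition is_zerop (R : realType) (a : R) : prog R bool := IsZero a Ret.
Definition ceilp (R : realType) (a : R) : prog R nat := Ceil a Ret.
Definition drawp (R : realType) (m : nat) (p : 'I_m -> R) : prog R 'I_m :=
  Draw p Ret.
Definition gaussp (R : realType) : prog R R := Gauss Ret.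

Fixpoint foreach (R : realType) (I X : Type) (s : seq I)
    (body : I -> X -> prog R X) (x : X) : prog R X :=
  match s with
  | [::] => Ret x
  | i :: s' => x' <-- body i x ;; foreach s' body x'
  end.

Fixpoint repeatp (R : realType) (X : Type) (k : nat) (body : X -> prog R X)
    (x : X) : prog R X :=
  match k with
  | 0%N => Ret x
  | k'.+1 => x' <-- body x ;; repeatp k' body x'
  end.

Definition set_entry (R : realType) (d : nat) (v : 'cV[R]_d) (j : 'I_d) (y : R) :
    'cV[R]_d :=
  \col_i (if i == j then y else v i 0).

Definition update_entries (R : realType) (d : nat) (s : seq 'I_d)
    (f : 'I_d -> R -> prog R R) (v : 'cV[R]_d) : prog R 'cV[R]_d :=
  foreach s
    (fun (j : 'I_d) (v : 'cV[R]_d) =>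
       y <-- f j (v j 0) ;; Ret (set_entry v j y)) v.

Definition sum_over (R : realType) (I : Type) (s : seq I) (f : I -> prog R R) :
    prog R R :=
  foreach s (fun j acc => y <-- f j ;; addp acc y) 0.

Definition scalep (R : realType) (d : nat) (c : R) (v : 'cV[R]_d) :
    prog R 'cV[R]_d :=
  update_entries (enum 'I_d) (fun _ y => mulp c y) v.

Definition vdivp (R : realType) (d : nat) (v : 'cV[R]_d) (c : R) :
    prog R 'cV[R]_d :=
  update_entries (enum 'I_d) (fun _ y => divp y c) v.

Definition vsubp (R : realType) (d : nat) (v w : 'cV[R]_d) : prog R 'cV[R]_d :=
  update_entries (enum 'I_d) (fun j y => subp y (w j 0)) v.

Definition gauss_vec (R : realType) (d : nat) : prog R 'cV[R]_d :=
  update_entries (enum 'I_d) (fun _ _ => gaussp R) 0.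

(* The zero vector has no direction; it is sent to an arbitrary unit vector. *)
Definition normalizep (R : realType) (d : nat) (v : 'cV[R]_d) :
    prog R 'cV[R]_d :=
  s <-- sum_over (enum 'I_d) (fun j => mulp (v j 0) (v j 0)) ;;
  z <-- is_zerop s ;;
  if z then
    t <-- sqrtp d%:R ;;
    vdivp (const_mx 1) t
  else
    t <-- sqrtp s ;;
    vdivp v t.

(* A is stored sparsely: its nonzero rows, and the nonzero entries of each,
   can be enumerated without cost. *)
Definition nz_rows (R : realType) (n d : nat) (A : 'M[R]_(n, d)) : seq 'I_n :=
  enum [pred i | row i A != 0].

Definition row_support (R : realType) (n d : nat) (A : 'M[R]_(n, d)) (i : 'I_n) :
    seq 'I_d :=
  enum [pred j | A i j != 0].

Definition row_dot (R : realType) (n d : nat) (A : 'M[R]_(n, d)) (i : 'I_n)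
    (x : 'cV[R]_d) : prog R R :=
  sum_over (row_support A i) (fun j => mulp (A i j) (x j 0)).

Definition sub_row (R : realType) (n d : nat) (A : 'M[R]_(n, d)) (i : 'I_n)
    (c : R) (v : 'cV[R]_d) : prog R 'cV[R]_d :=
  update_entries (row_support A i) (fun j y => t <-- mulp c (A i j) ;; subp y t) v.

(* With B = l I - A^T A, the system B x = b is solved by minimizing
   f(x) = x^T B x / 2 - b^T x = sum_i psi_i(x),
   psi_i(x) = x^T ((l |a_i|^2 / |A|_F^2) I - a_i a_i^T) x / 2 - b^T x / n,
   where a_i is the i-th row of A, sampled with probability
   p_i = |a_i|^2 / |A|_F^2. *)

(* l x - A^T A x - b *)
Definition grad_f (R : realType) (n d : nat) (A : 'M[R]_(n, d)) (l : R)
    (b x : 'cV[R]_d) : prog R 'cV[R]_d :=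
  g <-- scalep l x ;;
  h <-- foreach (nz_rows A)
          (fun i g => u <-- row_dot A i x ;; sub_row A i u g) g ;;
  vsubp h b.

(* (l p_i) x - (a_i^T x) a_i - b / n *)
Definition grad_psi (R : realType) (n d : nat) (A : 'M[R]_(n, d)) (l : R)
    (p : 'cV[R]_n) (b : 'cV[R]_d) (i : 'I_n) (x : 'cV[R]_d) : prog R 'cV[R]_d :=
  c <-- mulp l (p i 0) ;;
  g <-- scalep c x ;;
  u <-- row_dot A i x ;;
  h <-- sub_row A i u g ;;
  b' <-- vdivp b n%:R ;;
  vsubp h b'.

(* x - (eta / p_i) (grad psi_i (x) - grad psi_i (x0)) - eta g, with i ~ p and
   g = grad f (x0) *)
Definition svrg_step (R : realType) (n d : nat) (A : 'M[R]_(n, d)) (l eta : R)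
    (p : 'cV[R]_n) (b x0 g x : 'cV[R]_d) : prog R 'cV[R]_d :=
  i <-- drawp (fun i => p i 0) ;;
  gx <-- grad_psi A l p b i x ;;
  g0 <-- grad_psi A l p b i x0 ;;
  h <-- vsubp gx g0 ;;
  c <-- divp eta (p i 0) ;;
  h' <-- scalep c h ;;
  x' <-- vsubp x h' ;;
  e <-- scalep eta g ;;
  vsubp x' e.

(* The epoch returns the iterate of index k, with k uniform in {1, ..., M}. *)
Definition svrg_epoch (R : realType) (n d : nat) (A : 'M[R]_(n, d)) (l eta : R)
    (M : nat) (p : 'cV[R]_n) (b x0 : 'cV[R]_d) : prog R 'cV[R]_d :=
  g <-- grad_f A l b x0 ;;
  w <-- divp 1 M%:R ;;
  k <-- drawp (fun _ : 'I_M => w) ;;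
  repeatp k.+1 (svrg_step A l eta p b x0 g) x0.

Definition svrg_solve (R : realType) (n d : nat) (A : 'M[R]_(n, d)) (l eta : R)
    (M : nat) (p : 'cV[R]_n) (K : nat) (b : 'cV[R]_d) : prog R 'cV[R]_d :=
  repeatp K (svrg_epoch A l eta M p b) 0.

(* [T] power iterations, each solving its system by [K] epochs of SVRG with
   S = 2 |A|_F^2 l1 / (l - l1), eta = 1 / (8 S), M = ceil (64 S / (l - l1)). *)
Definition shift_invert_power (R : realType) (n d : nat) (A : 'M[R]_(n, d))
    (l1 l : R) (T K : nat) : prog R 'cV[R]_d :=
  q <-- update_entries (nz_rows A)
          (fun i _ => sum_over (row_support A i) (fun j => mulp (A i j) (A i j)))
          0 ;;
  F2 <-- sum_over (nz_rows A) (fun i => Ret (q i 0)) ;;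
  p <-- update_entries (nz_rows A) (fun _ y => divp y F2) q ;;
  mu <-- subp l l1 ;;
  s1 <-- mulp F2 l1 ;;
  s2 <-- mulp 2 s1 ;;
  S <-- divp s2 mu ;;
  S8 <-- mulp 8 S ;;
  eta <-- divp 1 S8 ;;
  S64 <-- mulp 64 S ;;
  r <-- divp S64 mu ;;
  M <-- ceilp r ;;
  x0 <-- gauss_vec R d ;;
  x <-- normalizep x0 ;;
  repeatp T
    (fun x => y <-- svrg_solve A l eta M p K x ;; normalizep y) x.

(* Main.v *)
(** Write B = l I - A^T A, mu = l - l1, and |x|_B^2 = x^T B x.  One SVRG epoch
    halves E |x - B^-1 b|_B^2, because the sampled gradients have second moment
    at most 2 |A|_F^2 l1 / mu times |.|_B^2; by Markov's inequality K epochs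
    apply B^-1 up to a relative error 1 / (24 T D^20) in |.|_B, where
    D = d / eps, outside an event of small probability.

    The power method is analysed without diagonalising A^T A.  Let v be a unit
    eigenvector for l1 and compare a = |x|_B, m = mu^(1/2) |x| and
    w = mu^(1/2) |<v, x>|, so that w <= m <= a.  An exact application of B^-1
    increases neither a / w nor a / m, and it divides a / w by 5 whenever the new
    a / m exceeds 5.  As a / w >= 1, after T steps a <= 10 m, which is the claimed
    bound on the Rayleigh quotient.  The only spectral input is that |A|_2^2 is
    an eigenvalue of A^T A.

    For the Gaussian start, the indicator of |<v, x0>| < c is dominated by
    2 exp (- <v, x0>^2 / 2 c^2), whose expectation is computed one coordinate at
    a time, and |x0|^2 is controlled by Markov's inequality. *)
Require Import Defs.
From mathcomp Require Import all_boot all_order all_algebra.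
From mathcomp Require Import all_classical all_reals all_analysis.
From mathcomp Require Import measurable_realfun ring lra zify.

Set Implicit Arguments.
Unset Strict Implicit.
Unset Printing Implicit Defensive.

Import Order.TTheory GRing.Theory Num.Theory.

Local Open Scope classical_set_scope.
Local Open Scope ring_scope.

(** For a unit vector, (a / m)^2 = (l - x^T A^T A x) / mu, so a / m is the Rayleigh quotient in
    disguise, and a <= 10 m costs at most 99 mu < eps l1. Without an eigengap a / m need not fall at
    a definite rate. A step that leaves it above 5 is therefore charged to a / w, and the bound a /
    w >= 1 limits how often this can happen.

    The constants come from the noise. An error measured against a has to be harmless against w as
    well, and w may be smaller by a factor 2 Psi, where Psi = D^20 bounds the initial ratio. The
    accuracy 1 / (24 T Psi) lets T steps worsen each ratio by a factor of at most 2. T of order ln D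
    makes 4^T exceed Psi, and K of order ln D makes 2^-K beat (24 T Psi)^2 by a margin that absorbs
    a union bound over the T steps.

    Probabilities are nested sums and integrals over continuations. Stating each expectation bound
    for all continuations at once makes such bounds compose under sequencing by associativity of
    [bind] alone. *)

Section programs.
Variable R : realType.

(** * Programs: deterministic runs, running time, expectation bounds *)

Lemma bindA (X Y Z : Type) (c : prog R X) (f : X -> prog R Y) (g : Y -> prog R Z) :
  bind (bind c f) g = bind c (fun x => bind (f x) g).
Proof.
elim: c => //= [ bop a b k IH|a k IH|a k IH|a k IH|m p k IH|k IH];
  f_equal; apply/funext => v; exact: IH.
Qed.

Lemma bind_ret (X : Type) (c : prog R X) : bind c Ret = c.
Proof.
elim: c => //= [ bop a b k IH|a k IH|a k IH|a k IH|m p k IH|k IH];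
  f_equal; apply/funext => v; exact: IH.
Qed.

(** Random instructions are excluded: a program that runs to a value can be replaced by that value
    inside [prob], [always] and, at a cost of at most [N], [time_le]. *)
Fixpoint runs (X : Type) (c : prog R X) (x : X) (N : nat) : Prop :=
  match c with
  | Ret y => y = x
  | Arith o a b k => (0 < N)%N /\ runs (k (eval_binop o a b)) x N.-1
  | Sqrt a k => (0 < N)%N /\ runs (k (Num.sqrt a)) x N.-1
  | IsZero a k => (0 < N)%N /\ runs (k (a == 0)) x N.-1
  | Ceil a k => (0 < N)%N /\ runs (k (nat_ceil a)) x N.-1
  | Draw _ _ _ => False
  | Gauss _ => False
  end.

Lemma runs_leq (X : Type) (c : prog R X) x N M :
  (N <= M)%N -> runs c x N -> runs c x M.
Proof.
elim: c N M => [z|bop a b k IH|a k IH|a k IH|a k IH|m p k IH|k IH] N M NM //=.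
all: by move=> [N0 h]; split; [lia | apply: IH h; lia].
Qed.

Lemma runs_bind (X Y : Type) (c : prog R X) (f : X -> prog R Y) x y N M :
  runs c x N -> runs (f x) y M -> runs (bind c f) y (N + M).
Proof.
elim: c N => [z|bop a b k IH|a k IH|a k IH|a k IH|m p k IH|k IH] N //=.
  by move=> -> h; apply: runs_leq h; lia.
all: move=> [N0 h1] h2; split; first lia.
all: have -> : ((N + M).-1 = N.-1 + M)%N by lia.
all: exact: IH.
Qed.

Lemma runs_prob (X Y : Type) (c : prog R X) (f : X -> prog R Y) x N Q :
  runs c x N -> prob (bind c f) Q = prob (f x) Q.
Proof.
elim: c N => [z|bop a b k IH|a k IH|a k IH|a k IH|m p k IH|k IH] N //=; first by move->.
all: by move=> [_ /IH].
Qed.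

Lemma runs_always (X Y : Type) (c : prog R X) (f : X -> prog R Y) x N Q :
  runs c x N -> always (f x) Q -> always (bind c f) Q.
Proof.
elim: c N => [z|bop a b k IH|a k IH|a k IH|a k IH|m p k IH|k IH] N //=; first by move->.
all: by move=> [_ /IH].
Qed.

Lemma time_leS (X : Type) (c : prog R X) N M : (N <= M)%N -> time_le c N -> time_le c M.
Proof.
elim: c N M => [z|bop a b k IH|a k IH|a k IH|a k IH|m p k IH|k IH] N M NM //= [N0 h];
 (split; first lia).
1-4: apply: IH h; lia.
all: move=> i; apply: IH (h i); lia.
Qed.

Lemma time_le_bind (X Y : Type) (c : prog R X) (f : X -> prog R Y) N M :
  time_le c N -> (forall x, time_le (f x) M) -> time_le (bind c f) (N + M).
Proof.
move=> + fM.
elim: c N => [z|bop a b k IH|a k IH|a k IH|a k IH|m p k IH|k IH] N //=.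
  by move=> _; apply: time_leS (fM z); lia.
all: move=> [N0 h]; (split; first lia); have -> : ((N + M).-1 = N.-1 + M)%N by lia.
1-4: exact: IH.
all: by move=> i; exact: IH.
Qed.

Lemma runs_time (X : Type) (c : prog R X) x N : runs c x N -> time_le c N.
Proof.
elim: c N => [z|bop a b k IH|a k IH|a k IH|a k IH|m p k IH|k IH] N //=.
all: by move=> [? /IH].
Qed.

Lemma runs_time_bind (X Y : Type) (c : prog R X) (f : X -> prog R Y) x N M :
  runs c x N -> time_le (f x) M -> time_le (bind c f) (N + M).
Proof.
elim: c N => [z|bop a b k IH|a k IH|a k IH|a k IH|m p k IH|k IH] N //=.
  by move=> -> h; apply: time_leS h; lia.
all: move=> [N0 h] h2; (split; first lia); have -> : ((N + M).-1 = N.-1 + M)%N by lia.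
all: exact: IH.
Qed.

Lemma always_bind (X Y : Type) (c : prog R X) (f : X -> prog R Y) Q :
  (forall x, always (f x) Q) -> always (bind c f) Q.
Proof.
move=> fQ; elim: c => //= [ bop a b k IH|a k IH|a k IH|a k IH]; exact: IH.
Qed.

Lemma runs_foreach (I X : Type) (s : seq I) (body : I -> X -> prog R X)
    (g : I -> X -> X) (t : I -> nat) x :
  (forall i x, runs (body i x) (g i x) (t i)) ->
  runs (foreach s body x) (foldl (fun x i => g i x) x s) (\sum_(i <- s) t i).
Proof.
move=> h; elim: s x => [|i s IH] x //=; rewrite big_cons.
exact: runs_bind (h i x) (IH _).
Qed.

Lemma time_le_repeatp (X : Type) (k : nat) (body : X -> prog R X) x N :
  (forall x, time_le (body x) N) -> time_le (repeatp k body x) (k * N).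
Proof.
move=> h; elim: k x => [|k IH] x //=; rewrite mulSn.
exact: time_le_bind.
Qed.

Lemma time_le_foreach (I X : Type) (s : seq I) (body : I -> X -> prog R X) x N :
  (forall i x, time_le (body i x) N) -> time_le (foreach s body x) (size s * N).
Proof.
move=> h; elim: s x => [|i s IH] x //=; rewrite mulSn.
exact: time_le_bind.
Qed.

(* The expectation of F over the outputs of c is at most b, phrased through lower
   bounds on the success probability of continuations so that no measurability of
   the continuation is needed. *)
Definition ebound (X : Type) (c : prog R X) (F : X -> R) (b : R) : Prop :=
  forall (Y : Type) (k : X -> prog R Y) (Q : set Y) (eta tau : R), 0 <= tau ->
  (forall x, (0 <= prob (k x) Q /\ (1 - (eta + tau * F x))%:E <= prob (k x) Q)%E) ->
  (0 <= prob (bind c k) Q /\ (1 - (eta + tau * b))%:E <= prob (bind c k) Q)%E.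

Lemma ebound_ret (X : Type) (x : X) F b : F x <= b -> ebound (Ret x) F b.
Proof.
move=> Fb Y k Q eta tau tau0 /(_ x) [h0 h1] /=; split=> //.
apply: le_trans h1; rewrite lee_fin; nra.
Qed.

(** After reassociation, [h] followed by any continuation is itself a continuation of [c]; this is
    the tower rule for expectations. *)
Lemma ebound_bind (X Y : Type) (c : prog R X) (h : X -> prog R Y) F G b :
  ebound c G b -> (forall x, ebound (h x) F (G x)) -> ebound (bind c h) F b.
Proof.
move=> cG hF Z k Q eta tau tau0 kQ; rewrite bindA.
apply: cG => // x; exact: hF.
Qed.

Lemma ebound_runs (X Y : Type) (c : prog R X) (h : X -> prog R Y) x N F b :
  runs c x N -> ebound (h x) F b -> ebound (bind c h) F b.
Proof.
move=> cx hF Z k Q eta tau tau0 kQ; rewrite bindA.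
rewrite (runs_prob _ _ cx); exact: hF.
Qed.

Lemma runs_ebound (X : Type) (c : prog R X) x N F b :
  runs c x N -> F x <= b -> ebound c F b.
Proof.
move=> cx Fb Z k Q eta tau tau0 kQ; rewrite (runs_prob _ _ cx).
exact: (ebound_ret Fb).
Qed.

(** The constant [u] is absorbed into [eta] and the factor [v] into [tau], which is why [ebound]
    quantifies over both. With [v = 0] it discards [F] and keeps only the fact that no mass is
    lost. *)
Lemma ebound_affine (X : Type) (c : prog R X) (F G : X -> R) b (u v : R) :
  0 <= v -> (forall x, G x <= u + v * F x) -> ebound c F b -> ebound c G (u + v * b).
Proof.
move=> v0 GF h Y k Q eta tau tau0 kQ.
have := h Y k Q (eta + tau * u) (tau * v) (mulr_ge0 tau0 v0).
have -> : eta + tau * (u + v * b) = eta + tau * u + tau * v * b by ring.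
apply=> x; have [k0 k1] := kQ x; split=> //; apply: le_trans k1.
rewrite lee_fin; have := ler_wpM2l tau0 (GF x); nra.
Qed.

Lemma ebound_le (X : Type) (c : prog R X) (F : X -> R) b b' :
  b <= b' -> ebound c F b -> ebound c F b'.
Proof.
move=> bb h Y k Q eta tau tau0 kQ; have [h0 h1] := h Y k Q eta tau tau0 kQ.
split=> //; apply: le_trans h1; rewrite lee_fin; nra.
Qed.

Lemma ebound_mono (X : Type) (c : prog R X) (F G : X -> R) b :
  (forall x, G x <= F x) -> ebound c F b -> ebound c G b.
Proof.
move=> GF h; have -> : b = 0 + 1 * b by rewrite add0r mul1r.
apply: ebound_affine h => // x; by rewrite add0r mul1r.
Qed.

Lemma ebound_draw (m : nat) (p : 'I_m -> R) (F : 'I_m -> R) :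
  (forall i, 0 <= p i) -> \sum_i p i = 1 ->
  ebound (drawp p) F (\sum_i p i * F i).
Proof.
move=> p0 p1 Y k Q eta tau tau0 kQ /=; split.
  by apply: sume_ge0 => i _; apply: mule_ge0; [rewrite lee_fin|case: (kQ i)].
have -> : 1 - (eta + tau * \sum_i p i * F i) = \sum_i p i * (1 - (eta + tau * F i)).
  rewrite [RHS](eq_bigr (fun i => (1 - eta) * p i + (- tau) * (p i * F i))); last first.
    by move=> i _; ring.
  by rewrite big_split /= -!mulr_sumr p1; ring.
rewrite -sumEFin; apply: lee_sum => i _; rewrite EFinM.
apply: lee_wpmul2l; [by rewrite lee_fin|by case: (kQ i)].
Qed.

Lemma ebound_prob (X : Type) (c : prog R X) (F : X -> R) b (Q : set X) :
  (forall x, 0 <= F x) -> (forall x, ~ Q x -> 1 <= F x) -> ebound c F b ->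
  ((1 - b)%:E <= prob c Q)%E.
Proof.
move=> F0 F1 h.
suff /(h X Ret Q 0 1 ler01) [_] : forall x, (0 <= prob (Ret x : prog R X) Q /\
    (1 - (0 + 1 * F x))%:E <= prob (Ret x : prog R X) Q)%E.
  by rewrite add0r mul1r bind_ret.
move=> x /=; rewrite add0r mul1r !lee_fin indicE.
have := F0 x; case: (boolP (x \in Q)) => [_|]; rewrite ?notin_setE => Fx /=.
  by split; lra.
by have := F1 _ Fx; split; lra.
Qed.

End programs.

(** * Integrals against the standard normal law *)

Section gauss.
Variable R : realType.
Local Notation mu := (@lebesgue_measure R).
Local Notation N01 := (normal_prob (0 : R) 1).

(** The integral of a nonnegative function is a supremum over the simple functions below it, and
    this supremum is monotone for arbitrary functions. *)
Lemma le_integral_nonmeasurable d (T : measurableType d)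
    (nu : {measure set T -> \bar R}) (g h : T -> \bar R) :
  (forall x, 0 <= g x)%E -> (forall x, g x <= h x)%E ->
  (\int[nu]_x g x <= \int[nu]_x h x)%E.
Proof.
move=> g0 gh.
have h0 x : (0 <= h x)%E by exact: le_trans (gh x).
rewrite !ge0_integralTE//; apply: ub_ereal_sup => _ [s sg <-].
apply: ereal_sup_ubound; exists s => // x; exact: le_trans (gh x).
Qed.

Lemma integral_ge_sub (h : R -> \bar R) (F : R -> R) (c b : R) :
  (forall z, 0 <= h z)%E -> (forall z, 0 <= F z) -> measurable_fun setT F ->
  (forall z, (c - F z)%:E <= h z)%E ->
  (\int[N01]_z (F z)%:E <= b%:E)%E ->
  ((c - b)%:E <= \int[N01]_z h z)%E.
Proof.
move=> h0 F0 mF hc Fb.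
pose g z := Num.max (c - F z) 0.
have mg : measurable_fun setT g.
  by apply: measurable_realfun.measurable_maxr => //; apply: measurable_funB.
have g0 z : 0 <= g z by rewrite le_max lexx orbT.
have le1 : (\int[N01]_z (g z)%:E <= \int[N01]_z h z)%E.
  apply: le_integral_nonmeasurable => z; first by rewrite lee_fin.
  by rewrite /g EFin_max ge_max hc h0.
apply: le_trans le1.
have [c0|c0] := leP c 0.
  apply: (@le_trans _ _ 0%E); last by apply: integral_ge0 => z _; rewrite lee_fin.
  have : (0 <= b%:E)%E.
    apply: le_trans Fb; by apply: integral_ge0 => z _; rewrite lee_fin.
  rewrite !lee_fin; lra.
rewrite EFinB leeBlDr //.
apply: (@le_trans _ _ (\int[N01]_z (g z)%:E + \int[N01]_z (F z)%:E)%E); last first.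
  by rewrite leeD2l.
rewrite -ge0_integralD//; last first.
- by apply/measurable_EFinP.
- by move=> z _; rewrite lee_fin.
- by apply/measurable_EFinP.
- by move=> z _; rewrite lee_fin.
have -> : c%:E = (\int[N01]_z c%:E)%E.
  by rewrite integral_cst// [X in (_ * X)%E]probability_setT mule1.
apply: le_integral_nonmeasurable => z; first by rewrite lee_fin ltW.
rewrite -EFinD lee_fin -lerBlDr /g le_max lexx//.
Qed.

(** The Radon-Nikodym derivative and the explicit density have the same integral over every
    measurable set, so they agree almost everywhere. *)
Lemma integral_normal_prob (m s : R) (f : R -> \bar R) :
  (forall x, 0 <= f x)%E -> measurable_fun setT f ->
  (\int[normal_prob m s]_x f x = \int[mu]_x (f x * (normal_pdf m s x)%:E))%E.
Proof.
move=> f0 mf.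
have dom := normal_prob_dominates m s.
rewrite -(Radon_Nikodym_SigmaFinite.change_of_variables dom f0 measurableT)//.
apply: ae_eq_integral => //.
- apply: emeasurable_funM => //.
  exact: measurable_int (Radon_Nikodym_SigmaFinite.f_integrable dom).
- apply: emeasurable_funM => //; apply/measurable_EFinP.
  exact: measurable_normal_pdf.
- apply: ae_eqe_mul2l => /=; apply: integral_ae_eq => //.
  + exact: Radon_Nikodym_SigmaFinite.f_integrable.
  + by apply/measurable_EFinP; exact: measurable_normal_pdf.
  + by move=> A _ mA; rewrite -Radon_Nikodym_SigmaFinite.f_integral.
Qed.

Lemma integral_normal_scaled_pdf (F : R -> R) (C m s : R) :
  (forall z, 0 <= F z) -> measurable_fun setT F -> 0 <= C ->
  (forall z, F z * normal_pdf 0 1 z = C * normal_pdf m s z) ->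
  (\int[N01]_z (F z)%:E = C%:E)%E.
Proof.
move=> F0 mF C0 FC.
rewrite integral_normal_prob//; last exact/measurable_EFinP.
under eq_integral do rewrite -EFinM FC EFinM.
rewrite ge0_integralZl//; last 2 first.
- by apply/measurable_EFinP; exact: measurable_normal_pdf.
- by move=> x _; rewrite lee_fin normal_pdf_ge0.
by rewrite integral_normal_pdf mule1.
Qed.

Lemma integral_normal_gaussian (u a t : R) : 0 < t ->
  (\int[N01]_z (expR (- (u + a * z) ^+ 2 / (2 * t)))%:E =
   (Num.sqrt (t / (t + a ^+ 2)) * expR (- u ^+ 2 / (2 * (t + a ^+ 2))))%:E)%E.
Proof.
move=> t0.
have a20 : 0 <= a ^+ 2 by rewrite sqr_ge0.
have ta : 0 < t + a ^+ 2 by lra.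
have q0 : 0 < t / (t + a ^+ 2) by rewrite divr_gt0.
set s := Num.sqrt (t / (t + a ^+ 2)).
have s0 : 0 < s by rewrite sqrtr_gt0.
have s2 : s ^+ 2 = t / (t + a ^+ 2) by rewrite sqr_sqrtr// ltW.
(* Completing the square turns kernel times density into a multiple of the normal density with this
   mean and with variance t / (t + a^2). *)
apply: (@integral_normal_scaled_pdf _ _ (- a * u / (t + a ^+ 2)) s).
- by move=> z; exact: expR_ge0.
- apply: measurableT_comp => //=; apply: measurable_funM => //=.
  apply: measurableT_comp => //=; apply: measurable_funX => //=.
  apply: measurable_funD => //; exact: measurable_funM.
- by rewrite mulr_ge0// ?expR_ge0// ltW.
move=> z.
rewrite !normal_pdfE ?oner_eq0 ?gt_eqF// /normal_peak.
have -> : Num.sqrt (s ^+ 2 * pi *+ 2) = s * Num.sqrt (1 ^+ 2 * pi *+ 2) :> R.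
  rewrite -mulrnAr sqrtrM ?sqr_ge0// sqrtr_sqr gtr0_norm// expr1n mul1r//.
set P := Num.sqrt (1 ^+ 2 * pi *+ 2).
have P0 : P != 0.
  by rewrite gt_eqF// sqrtr_gt0 expr1n mul1r mulrn_wgt0// pi_gt0.
rewrite /normal_fun mulrCA -expRD.
have -> : - (u + a * z) ^+ 2 / (2 * t) + - (z - 0) ^+ 2 / (1 ^+ 2 *+ 2) =
    - u ^+ 2 / (2 * (t + a ^+ 2)) +
    - (z - - a * u / (t + a ^+ 2)) ^+ 2 / (s ^+ 2 *+ 2).
  by rewrite s2; field; rewrite !gt_eqF//.
rewrite expRD; set E1 := expR _; set E2 := expR _.
by field; rewrite P0 gt_eqF.
Qed.

(** Since z^2 <= 4 exp (z^2 / 4), and this majorant times the density is a multiple of the normal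
    density of variance 2, the integral is at most 4 sqrt 2 < 6. A constant suffices, so the exact
    second moment is not computed. *)
Lemma integral_normal_sqr_le :
  (\int[N01]_z (z ^+ 2)%:E <= 6%:E)%E.
Proof.
pose F (z : R) := 4 * expR (z ^+ 2 / 4).
have mF : measurable_fun setT F.
  apply: measurable_funM => //; apply: measurableT_comp => //=.
  apply: measurable_funM => //; exact: measurable_funX.
have F0 z : 0 <= F z by rewrite mulr_ge0// expR_ge0.
apply: (@le_trans _ _ (\int[N01]_z (F z)%:E)%E).
  apply: le_integral_nonmeasurable => z; first by rewrite lee_fin sqr_ge0.
  rewrite lee_fin /F; have := expR_ge1Dx (z ^+ 2 / 4); lra.
have s2E : Num.sqrt (2 : R) ^+ 2 = 2 by rewrite sqr_sqrtr.
have s20 : 0 < Num.sqrt (2 : R) by rewrite sqrtr_gt0.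
rewrite (@integral_normal_scaled_pdf F (4 * Num.sqrt 2) 0 (Num.sqrt 2))//.
  by rewrite lee_fin; nra.
move=> z; rewrite !normal_pdfE ?oner_eq0 ?gt_eqF// /normal_peak.
have -> : Num.sqrt (Num.sqrt 2 ^+ 2 * pi *+ 2) =
    Num.sqrt 2 * Num.sqrt (1 ^+ 2 * pi *+ 2) :> R.
  by rewrite -mulrnAr sqrtrM ?sqr_ge0// sqrtr_sqr gtr0_norm// expr1n mul1r.
set P := Num.sqrt (1 ^+ 2 * pi *+ 2).
have P0 : P != 0.
  by rewrite gt_eqF// sqrtr_gt0 expr1n mul1r mulrn_wgt0// pi_gt0.
rewrite /normal_fun /F -mulrA [expR _ * _]mulrCA -expRD.
have -> : z ^+ 2 / 4 + - (z - 0) ^+ 2 / (1 ^+ 2 *+ 2) =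
    - (z - 0) ^+ 2 / (Num.sqrt 2 ^+ 2 *+ 2).
  by rewrite s2E; field.
set E1 := expR _.
by field; rewrite P0 gt_eqF.
Qed.

End gauss.

(** * Values and costs of the vector and sparse matrix subroutines *)

Section vector_programs.
Variable R : realType.

Lemma runs_update_entries d (s : seq 'I_d) (f : 'I_d -> R -> prog R R)
    (g : 'I_d -> R -> R) (t : 'I_d -> nat) (v : 'cV[R]_d) : uniq s ->
  (forall j y, runs (f j y) (g j y) (t j)) ->
  runs (update_entries s f v)
       (\col_i (if i \in s then g i (v i 0) else v i 0)) (\sum_(j <- s) t j).
Proof.
move=> us h.
pose g' j (v : 'cV[R]_d) := set_entry v j (g j (v j 0)).
have -> : \col_i (if i \in s then g i (v i 0) else v i 0) =
    foldl (fun v j => g' j v) v s.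
  elim: s v us => [|j s IH] v /=; first by move=> _; apply/colP => i; rewrite mxE.
  move=> /andP[js us]; rewrite -IH//; apply/colP => i; rewrite !mxE in_cons.
  by case: (eqVneq i j) => [->|] //=; rewrite (negbTE js).
apply: runs_foreach => j w; rewrite -[t j]addn0.
by apply: runs_bind (h j _) _.
Qed.

Lemma runs_sum_over (I : Type) (s : seq I) (f : I -> prog R R) (g : I -> R)
    (t : I -> nat) : (forall j, runs (f j) (g j) (t j)) ->
  runs (sum_over s f) (\sum_(j <- s) g j) (\sum_(j <- s) (t j).+1).
Proof.
move=> h.
have -> : \sum_(j <- s) g j = foldl (fun a j => a + g j) 0 s.
  suff H a : a + \sum_(j <- s) g j = foldl (fun a j => a + g j) a s by rewrite -H add0r.
  elim: s a => [|j s IH] a /=; first by rewrite big_nil addr0.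
  by rewrite big_cons addrA IH.
apply: runs_foreach => j a; rewrite -addn1.
exact: runs_bind (h j) _.
Qed.

Lemma sum_nat_seq_const (I : Type) (s : seq I) c : (\sum_(j <- s) c = size s * c)%N.
Proof. by rewrite big_const_seq count_predT iter_addn_0 mulnC. Qed.

Lemma runs_update_all d (f : 'I_d -> R -> prog R R)
    (g : 'I_d -> R -> R) (v w : 'cV[R]_d) :
  (forall j y, runs (f j y) (g j y) 1) -> (forall i, w i 0 = g i (v i 0)) ->
  runs (update_entries (enum 'I_d) f v) w d.
Proof.
move=> h hw; have := runs_update_entries v (enum_uniq 'I_d) h.
rewrite sum1_size size_enum_ord.
congr (runs _ _ _); apply/colP => i; by rewrite mxE mem_enum inE hw.
Qed.

Lemma runs_scalep d (c : R) (v : 'cV[R]_d) : runs (scalep c v) (c *: v) d.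
Proof. by apply: (@runs_update_all _ _ (fun _ y => c * y)) => // i; rewrite mxE. Qed.

Lemma runs_vdivp d (v : 'cV[R]_d) (c : R) : runs (vdivp v c) (c^-1 *: v) d.
Proof.
by apply: (@runs_update_all _ _ (fun _ y => y / c)) => // i; rewrite mxE mulrC.
Qed.

Lemma runs_vsubp d (v w : 'cV[R]_d) : runs (vsubp v w) (v - w) d.
Proof.
by apply: (@runs_update_all _ _ (fun j y => y - w j 0)) => // i; rewrite !mxE.
Qed.

Lemma sum_sqr_ge0 d (v : 'cV[R]_d) : 0 <= \sum_i v i 0 ^+ 2.
Proof. by apply: sumr_ge0 => i _; exact: sqr_ge0. Qed.

Lemma sqr_norm2 d (v : 'cV[R]_d) : norm2 v ^+ 2 = \sum_i v i 0 ^+ 2.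
Proof. by rewrite sqr_sqrtr// sum_sqr_ge0. Qed.

Lemma norm2_ge0 d (v : 'cV[R]_d) : 0 <= norm2 v.
Proof. exact: sqrtr_ge0. Qed.

Lemma norm2_eq0 d (v : 'cV[R]_d) : (norm2 v == 0) = (v == 0).
Proof.
rewrite -sqrf_eq0 sqr_norm2 psumr_eq0; last by move=> i _; exact: sqr_ge0.
apply/allP/eqP => [h|-> i _]; last by rewrite mxE expr0n /= eqxx.
apply/colP => i; rewrite mxE; apply/eqP; rewrite -sqrf_eq0.
by have /= := h _ (mem_index_enum i).
Qed.

Lemma norm2Z d (c : R) (v : 'cV[R]_d) : norm2 (c *: v) = `|c| * norm2 v.
Proof.
rewrite /norm2 -sqrtr_sqr -sqrtrM ?sqr_ge0// mulr_sumr; congr Num.sqrt.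
by apply: eq_bigr => i _; rewrite mxE exprMn.
Qed.

Definition unitv d (v : 'cV[R]_d) : 'cV[R]_d :=
  if v == 0 then (Num.sqrt d%:R)^-1 *: const_mx 1 else (norm2 v)^-1 *: v.

Lemma norm2_unitv d (v : 'cV[R]_d) : (0 < d)%N -> norm2 (unitv v) = 1.
Proof.
move=> d0; rewrite /unitv; case: ifPn => v0; rewrite norm2Z.
  rewrite /norm2 (eq_bigr (fun _ => 1)); last by move=> i _; rewrite mxE expr1n.
  rewrite sumr_const card_ord ger0_norm ?invr_ge0 ?sqrtr_ge0// mulVf//.
  by rewrite gt_eqF// sqrtr_gt0 ltr0n.
by rewrite ger0_norm ?invr_ge0 ?norm2_ge0// mulVf// norm2_eq0.
Qed.

Lemma runs_normalizep d (v : 'cV[R]_d) : runs (normalizep v) (unitv v) (3 * d + 2).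
Proof.
have -> : (3 * d + 2 = 2 * d + (1 + (1 + d)))%N by lia.
have h := @runs_sum_over _ (enum 'I_d) (fun j => mulp (v j 0) (v j 0))
  (fun j => v j 0 * v j 0) (fun=> 1%N) (fun j => conj erefl erefl).
have sE : \sum_(j <- enum 'I_d) v j 0 * v j 0 = norm2 v ^+ 2.
  by rewrite sqr_norm2 big_enum; apply: eq_bigr => i _; rewrite expr2.
rewrite sE in h.
rewrite sum_nat_seq_const size_enum_ord mulnC in h.
apply: runs_bind h _; apply: (@runs_bind _ _ _ _ _ (norm2 v ^+ 2 == 0)) => //.
rewrite sqrf_eq0 norm2_eq0 /unitv; case: ifPn => v0.
  by apply: (@runs_bind _ _ _ _ _ (Num.sqrt d%:R)) => //; exact: runs_vdivp.
apply: (@runs_bind _ _ _ _ _ (Num.sqrt (norm2 v ^+ 2))) => //.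
rewrite sqrtr_sqr ger0_norm ?norm2_ge0//; exact: runs_vdivp.
Qed.

Variables (n d : nat) (A : 'M[R]_(n, d)).

Lemma sum_row_support (i : 'I_n) (f : 'I_d -> R) :
  (forall j, A i j = 0 -> f j = 0) ->
  \sum_(j <- row_support A i) f j = \sum_j f j.
Proof.
move=> f0; rewrite /row_support big_enum_cond big_mkcond /=; apply: eq_bigr => j _.
by rewrite inE; case: eqVneq => // /f0.
Qed.

Lemma sum_nz_rows (V : zmodType) (f : 'I_n -> V) :
  (forall i, row i A = 0 -> f i = 0) ->
  \sum_(i <- nz_rows A) f i = \sum_i f i.
Proof.
move=> f0; rewrite /nz_rows big_enum_cond big_mkcond /=; apply: eq_bigr => i _.
by rewrite inE; case: eqVneq => // /f0.
Qed.

Lemma size_row_support i : (size (row_support A i) <= d)%N.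
Proof. by rewrite -cardE; apply: leq_trans (max_card _) _; rewrite card_ord. Qed.

Lemma sum_size_row_support : (\sum_(i <- nz_rows A) size (row_support A i) = nnz A)%N.
Proof.
rewrite /nnz cardsE -sum1_card.
rewrite -(pair_big_dep xpredT (fun i j => A i j != 0) (fun _ _ => 1%N))/=.
rewrite /nz_rows big_enum_cond [LHS]big_mkcond /=; apply: eq_bigr => i _.
rewrite inE; case: eqVneq => [r0|_].
  rewrite big1// => j; have : row i A 0 j = 0 by rewrite r0 mxE.
  by rewrite mxE => ->; rewrite eqxx.
by rewrite sum1_card /row_support -cardE; apply: eq_card => j; rewrite !inE.
Qed.

Lemma size_nz_rows : (size (nz_rows A) <= nnz A)%N.
Proof.
rewrite -sum_size_row_support -sum1_size.
rewrite !big_seq; apply: leq_sum => i; rewrite mem_enum inE => /negP ri.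
rewrite /row_support -cardE lt0n; apply/negP => /eqP/card0_eq h.
apply: ri; apply/eqP/rowP => j; rewrite !mxE.
by have := h j; rewrite inE => /negbFE/eqP.
Qed.

Lemma runs_row_dot i (x : 'cV[R]_d) :
  runs (row_dot A i x) ((A *m x) i 0) (2 * size (row_support A i)).
Proof.
have := @runs_sum_over _ (row_support A i) (fun j => mulp (A i j) (x j 0))
  (fun j => A i j * x j 0) (fun=> 1%N) (fun j => conj erefl erefl).
rewrite sum_row_support; last by move=> j ->; rewrite mul0r.
by rewrite sum_nat_seq_const mulnC mxE.
Qed.

Lemma runs_sub_row i c (v : 'cV[R]_d) :
  runs (sub_row A i c v) (v - c *: (row i A)^T) (2 * size (row_support A i)).
Proof.
have h j y : runs (t <-- mulp c (A i j);; subp y t) (y - c * A i j) 2.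
  exact: (@runs_bind _ _ _ _ _ (c * A i j) _ 1 1).
have := runs_update_entries v (enum_uniq [pred j | A i j != 0]) h.
rewrite sum_nat_seq_const mulnC.
congr (runs _ _ _); apply/colP => j; rewrite !mxE mem_enum inE.
by case: eqVneq => // ->; rewrite mulr0 subr0.
Qed.

Lemma sum_rows_outer (x : 'cV[R]_d) :
  \sum_i (A *m x) i 0 *: (row i A)^T = A^T *m A *m x.
Proof.
apply/colP => j; rewrite -mulmxA summxE [RHS]mxE; apply: eq_bigr => i _.
by rewrite [LHS]mxE [((row i A)^T) _ _]mxE [row i A _ _]mxE [A^T _ _]mxE mulrC.
Qed.

Lemma runs_grad_f l (b x : 'cV[R]_d) :
  runs (grad_f A l b x) (l *: x - A^T *m A *m x - b) (2 * d + 4 * nnz A).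
Proof.
have -> : (2 * d + 4 * nnz A = d + (4 * nnz A + d))%N by lia.
apply: runs_bind (runs_scalep _ _) _.
suff H : runs (foreach (nz_rows A)
    (fun i g => u <-- row_dot A i x ;; sub_row A i u g) (l *: x))
    (l *: x - A^T *m A *m x) (4 * nnz A) by apply: (runs_bind H); exact: runs_vsubp.
have h i (g : 'cV[R]_d) : runs (u <-- row_dot A i x ;; sub_row A i u g)
    (g - (A *m x) i 0 *: (row i A)^T) (4 * size (row_support A i)).
  rewrite (mulnDl 2 2).
  exact: runs_bind (runs_row_dot _ _) (runs_sub_row _ _ _).
have := runs_foreach (nz_rows A) (l *: x) h.
rewrite -big_distrr /= sum_size_row_support.
congr (runs _ _ _).
rewrite -sum_rows_outer -sum_nz_rows; last by move=> i ->; rewrite trmx0 scaler0.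
elim: (nz_rows A) (l *: x) => [|i s IH] g /=; first by rewrite big_nil subr0.
by rewrite IH big_cons opprD addrA.
Qed.

Lemma runs_grad_psi l (p : 'cV[R]_n) (b : 'cV[R]_d) i (x : 'cV[R]_d) :
  runs (grad_psi A l p b i x)
    ((l * p i 0) *: x - (A *m x) i 0 *: (row i A)^T - n%:R^-1 *: b) (7 * d + 1).
Proof.
have hs := size_row_support i.
apply: (@runs_leq _ _ _ _ (1 + (d + (2 * size (row_support A i) +
  (2 * size (row_support A i) + (d + d)))))); first lia.
apply: (@runs_bind _ _ _ _ _ (l * p i 0)) => //.
apply: runs_bind (runs_scalep _ _) _.
apply: runs_bind (runs_row_dot _ _) _.
apply: runs_bind (runs_sub_row _ _ _) _.
apply: runs_bind (runs_vdivp _ _) _.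
exact: runs_vsubp.
Qed.

(** The terms b / n cancel between the two sampled gradients, so only [x - x0] enters the
    correction. *)
Definition step_val (l eta : R) (p : 'cV[R]_n) (x0 g x : 'cV[R]_d) (i : 'I_n) :=
  x - (eta / p i 0) *:
        ((l * p i 0) *: (x - x0) - (A *m (x - x0)) i 0 *: (row i A)^T)
    - eta *: g.

Lemma runs_svrg_step_tail (l eta : R) (p : 'cV[R]_n) (b x0 g x : 'cV[R]_d) (i : 'I_n) :
  runs (gx <-- grad_psi A l p b i x ;;
        g0 <-- grad_psi A l p b i x0 ;;
        h <-- vsubp gx g0 ;;
        c <-- Defs.divp eta (p i 0) ;;
        h' <-- scalep c h ;;
        x' <-- vsubp x h' ;;
        e <-- scalep eta g ;;
        vsubp x' e) (step_val l eta p x0 g x i) (19 * d + 3).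
Proof.
have -> : (19 * d + 3 =
    (7 * d + 1) + ((7 * d + 1) + (d + (1 + (d + (d + (d + d)))))))%N by lia.
apply: runs_bind (runs_grad_psi _ _ _ _ _) _.
apply: runs_bind (runs_grad_psi _ _ _ _ _) _.
apply: runs_bind (runs_vsubp _ _) _.
apply: (@runs_bind _ _ _ _ _ (eta / p i 0)) => //.
apply: runs_bind (runs_scalep _ _) _.
apply: runs_bind (runs_vsubp _ _) _.
apply: runs_bind (runs_scalep _ _) _.
pose gpsi z := (l * p i 0) *: z - (A *m z) i 0 *: (row i A)^T - n%:R^-1 *: b.
have := runs_vsubp (x - (eta / p i 0) *: (gpsi x - gpsi x0)) (eta *: g).
rewrite /gpsi.
congr (runs _ _ _); rewrite /step_val; congr (_ - _ *: _ - _).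
have -> : (A *m (x - x0)) i 0 = (A *m x) i 0 - (A *m x0) i 0.
  by rewrite mulmxBr mxE [X in _ + X]mxE.
set u := (A *m x) i 0; set u0 := (A *m x0) i 0.
by apply/colP => j; rewrite !mxE; ring.
Qed.

End vector_programs.

(** * Bilinear forms of matrices and Cauchy-Schwarz *)

Section bilinear_form.
Variable R : realType.

Definition mxform d (P : 'M[R]_d) (x y : 'cV[R]_d) : R := (x^T *m P *m y) 0 0.

Lemma formDl d (P : 'M[R]_d) x y z : mxform P (x + y) z = mxform P x z + mxform P y z.
Proof. by rewrite /mxform linearD /= !mulmxDl mxE. Qed.

Lemma formDr d (P : 'M[R]_d) x y z : mxform P z (x + y) = mxform P z x + mxform P z y.
Proof. by rewrite /mxform mulmxDr mxE. Qed.

Lemma formZl d (P : 'M[R]_d) c x y : mxform P (c *: x) y = c * mxform P x y.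
Proof. by rewrite /mxform linearZ /= -!scalemxAl mxE. Qed.

Lemma formZr d (P : 'M[R]_d) c x y : mxform P x (c *: y) = c * mxform P x y.
Proof. by rewrite /mxform -scalemxAr mxE. Qed.

Lemma formNl d (P : 'M[R]_d) x y : mxform P (- x) y = - mxform P x y.
Proof. by rewrite -scaleN1r formZl mulN1r. Qed.

Lemma formNr d (P : 'M[R]_d) x y : mxform P x (- y) = - mxform P x y.
Proof. by rewrite -scaleN1r formZr mulN1r. Qed.

Lemma form_sumr d (P : 'M[R]_d) (I : Type) (s : seq I) (f : I -> 'cV[R]_d) x :
  mxform P x (\sum_(i <- s) f i) = \sum_(i <- s) mxform P x (f i).
Proof. by rewrite /mxform mulmx_sumr summxE. Qed.

Lemma formC d (P : 'M[R]_d) x y : P^T = P -> mxform P x y = mxform P y x.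
Proof.
move=> PT; rewrite /mxform.
have -> : (x^T *m P *m y) 0 0 = (x^T *m P *m y)^T 0 0 by rewrite [RHS]mxE.
by rewrite !trmx_mul trmxK PT mulmxA.
Qed.

Lemma form_mulr d (P Q : 'M[R]_d) x y : mxform P x (Q *m y) = mxform (P *m Q) x y.
Proof. by rewrite /mxform !mulmxA. Qed.

Lemma form1_mulr d (Q : 'M[R]_d) x y : mxform 1%:M x (Q *m y) = mxform Q x y.
Proof. by rewrite form_mulr mul1mx. Qed.

Lemma form1E d (x y : 'cV[R]_d) : mxform 1%:M x y = \sum_i x i 0 * y i 0.
Proof. by rewrite /mxform mulmx1 mxE; apply: eq_bigr => i _; rewrite mxE. Qed.

Lemma form1_norm2 d (x : 'cV[R]_d) : mxform 1%:M x x = norm2 x ^+ 2.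
Proof. by rewrite form1E sqr_norm2; apply: eq_bigr => i _; rewrite expr2. Qed.

Lemma form1_ge0 d (x : 'cV[R]_d) : 0 <= mxform 1%:M x x.
Proof. by rewrite form1_norm2 sqr_ge0. Qed.

Lemma form1_eq0 d (x : 'cV[R]_d) : (mxform 1%:M x x == 0) = (x == 0).
Proof. by rewrite form1_norm2 sqrf_eq0 norm2_eq0. Qed.

Lemma form_gram n d (A : 'M[R]_(n, d)) x :
  mxform (A^T *m A) x x = mxform 1%:M (A *m x) (A *m x).
Proof. by rewrite /mxform trmx_mul mulmx1 !mulmxA. Qed.

Lemma form_gram_ge0 n d (A : 'M[R]_(n, d)) x : 0 <= mxform (A^T *m A) x x.
Proof. by rewrite form_gram form1_ge0. Qed.

Lemma form_shift d (P : 'M[R]_d) a x y :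
  mxform (a%:M - P) x y = a * mxform 1%:M x y - mxform P x y.
Proof.
rewrite /mxform mulmxBr mulmxBl [LHS]mxE [X in _ + X]mxE; congr (_ - _).
by rewrite mul_mx_scalar -scalemxAl mulmx1 mxE.
Qed.

Lemma gram_sym n d (A : 'M[R]_(n, d)) : (A^T *m A)^T = A^T *m A.
Proof. by rewrite trmx_mul trmxK. Qed.

Lemma shift_sym d (P : 'M[R]_d) a : P^T = P -> (a%:M - P)^T = a%:M - P.
Proof. by move=> PT; rewrite linearB /= tr_scalar_mx PT. Qed.

(** The form is only semidefinite, so [mxform P y y] may vanish. The quadratic in [t] is then
    affine, and a nonzero slope would let it reach -1; otherwise its minimum at -b / c gives the
    inequality. *)
Lemma form_cauchy_schwarz d (P : 'M[R]_d) x y : P^T = P ->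
  (forall z, 0 <= mxform P z z) -> mxform P x y ^+ 2 <= mxform P x x * mxform P y y.
Proof.
move=> PT P0.
set a := mxform P x x; set b := mxform P x y; set c := mxform P y y.
have c0 : 0 <= c by exact: P0.
have H t : 0 <= a + 2 * t * b + t ^+ 2 * c.
  have := P0 (x + t *: y).
  rewrite formDl !formDr !formZl !formZr (formC y x PT) -/a -/b -/c; lra.
have [c00|cn0] := eqVneq c 0.
  have [b0|b0] := eqVneq b 0; first by rewrite b0 c00 expr0n mulr0.
  have := H (- (a + 1) / (2 * b)); rewrite c00 mulr0 addr0.
  have -> : a + 2 * (- (a + 1) / (2 * b)) * b = -1 by field.
  lra.
have cgt : 0 < c by rewrite lt_neqAle eq_sym cn0.
have := H (- b / c).
have -> : a + 2 * (- b / c) * b + (- b / c) ^+ 2 * c = (a * c - b ^+ 2) / c by field.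
by rewrite pmulr_lge0 ?invr_gt0// subr_ge0.
Qed.

Lemma norm2_mulmx_le n d (A : 'M[R]_(n, d)) x :
  norm2 (A *m x) <= frobenius_norm A * norm2 x.
Proof.
rewrite /frobenius_norm /norm2 -sqrtrM; last first.
  by apply: sumr_ge0 => i _; apply: sumr_ge0 => j _; exact: sqr_ge0.
rewrite ler_wsqrtr// mulr_suml; apply: ler_sum => i _.
have := @form_cauchy_schwarz d 1%:M (row i A)^T x (trmx1 _ _) (@form1_ge0 d).
rewrite !form1E !mxE.
under eq_bigr do rewrite !mxE.
under [X in _ <= X * _ -> _]eq_bigr do rewrite !mxE -expr2.
by under [X in _ <= _ * X -> _]eq_bigr do rewrite -expr2.
Qed.

Lemma sqr_frobenius_norm n d (A : 'M[R]_(n, d)) :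
  frobenius_norm A ^+ 2 = \sum_i mxform 1%:M (row i A)^T (row i A)^T.
Proof.
rewrite sqr_sqrtr; last first.
  by apply: sumr_ge0 => i _; apply: sumr_ge0 => j _; exact: sqr_ge0.
by apply: eq_bigr => i _; rewrite form1E; apply: eq_bigr => j _; rewrite !mxE expr2.
Qed.

Lemma norm2_delta d (j : 'I_d) : norm2 (delta_mx j 0 : 'cV[R]_d) = 1.
Proof.
rewrite /norm2 (bigD1 j)//= big1 ?addr0 ?mxE ?eqxx ?expr1n ?sqrtr1//.
by move=> i ij; rewrite mxE (negbTE ij) expr0n.
Qed.

End bilinear_form.

(** * The spectral norm and the largest eigenvalue of the Gram matrix *)

Section spectral.
Variables (R : realType) (n d : nat) (A : 'M[R]_(n, d)).
Local Notation Sig := (A^T *m A).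

Lemma spectral_norm_ub x : norm2 x = 1 -> norm2 (A *m x) <= spectral_norm A.
Proof.
move=> x1; apply: ub_le_sup; last by exists x.
exists (frobenius_norm A) => _ [y /= y1 <-].
by apply: le_trans (norm2_mulmx_le A y) _; rewrite y1 mulr1.
Qed.

Lemma spectral_norm_le c : (0 < d)%N ->
  (forall x, norm2 x = 1 -> norm2 (A *m x) <= c) -> spectral_norm A <= c.
Proof.
move=> d0 h; apply: ge_sup; last by move=> _ [x /= x1 <-]; exact: h.
by exists (norm2 (A *m delta_mx (Ordinal d0) 0)); exists (delta_mx (Ordinal d0) 0) => //;
  exact: norm2_delta.
Qed.

Lemma spectral_norm_mulmx x : norm2 (A *m x) <= spectral_norm A * norm2 x.
Proof.
have [->|x0] := eqVneq x 0.
  have z0 k : norm2 (0 : 'cV[R]_k) = 0 by apply/eqP; rewrite norm2_eq0.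
  by rewrite mulmx0 !z0 mulr0.
have nx : 0 < norm2 x by rewrite lt_neqAle eq_sym norm2_eq0 x0 norm2_ge0.
have := @spectral_norm_ub ((norm2 x)^-1 *: x).
rewrite -scalemxAr !norm2Z gtr0_norm ?invr_gt0// mulVf ?gt_eqF// => /(_ erefl).
by rewrite ler_pdivrMl// mulrC.
Qed.

Lemma spectral_norm_ge0 : (0 < d)%N -> 0 <= spectral_norm A.
Proof.
move=> d0; apply: le_trans (spectral_norm_ub (norm2_delta R (Ordinal d0))).
exact: norm2_ge0.
Qed.

Lemma nonzero_dim : A != 0 -> (0 < d)%N.
Proof. by case: d A => // A' /eqP []; apply/matrixP => i [[]]. Qed.

Lemma spectral_norm_gt0 : A != 0 -> 0 < spectral_norm A.
Proof.
move=> A0; have d0 := nonzero_dim A0.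
rewrite lt_neqAle spectral_norm_ge0// andbT eq_sym; apply: contra A0 => /eqP s0.
apply/eqP/matrixP => i j; rewrite mxE.
have := spectral_norm_mulmx (delta_mx j 0); rewrite s0 mul0r => h.
have /eqP : norm2 (A *m delta_mx j 0) = 0 by apply/eqP; rewrite eq_le h norm2_ge0.
by rewrite norm2_eq0 -colE => /eqP/colP/(_ i); rewrite !mxE.
Qed.

Lemma rayleigh_spectral_norm x :
  mxform Sig x x <= spectral_norm A ^+ 2 * mxform 1%:M x x.
Proof.
rewrite form_gram !form1_norm2 -exprMn ler_sqr ?nnegrE ?norm2_ge0//.
  exact: spectral_norm_mulmx.
by apply: le_trans (spectral_norm_mulmx x); exact: norm2_ge0.
Qed.

(* Otherwise s I - A^T A, with s = |A|_2^2, would be invertible and positive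
   semidefinite, hence coercive, and the supremum |A|_2 could be lowered. *)
Lemma spectral_norm_eigenvalue : A != 0 -> eigenvalue Sig (spectral_norm A ^+ 2).
Proof.
move=> A0; have d0 := nonzero_dim A0; have sg := spectral_norm_gt0 A0.
set s := spectral_norm A ^+ 2.
have s0 : 0 < s by rewrite exprn_gt0.
apply/negP; rewrite /eigenspace kermx_eq0 row_free_unit => Nu'.
have Nu : s%:M - Sig \in unitmx by rewrite -opprB -scaleN1r unitmxZ// unitrN1.
set N := s%:M - Sig in Nu *.
have NT : N^T = N by apply: shift_sym; exact: gram_sym.
have N0 z : 0 <= mxform N z z by rewrite form_shift subr_ge0 rayleigh_spectral_norm.
pose c := frobenius_norm (invmx N) ^+ 2.
have c0 : 0 <= c by rewrite sqr_ge0.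
have H1 x : mxform 1%:M x x <= c * mxform 1%:M (N *m x) (N *m x).
  rewrite !form1_norm2 -exprMn -{1}[x](mulKmx Nu).
  rewrite ler_sqr ?nnegrE ?norm2_ge0 ?mulr_ge0 ?norm2_ge0 ?sqrtr_ge0//.
  exact: norm2_mulmx_le.
(* Cauchy-Schwarz for the form [N] at x and y = N x, together with N <= s I, gives |y|^4 <= <x, N x>
   s |y|^2. *)
have H2 x : mxform 1%:M (N *m x) (N *m x) <= s * mxform N x x.
  set y := N *m x; set k := mxform 1%:M y y.
  have k0 : 0 <= k by exact: form1_ge0.
  have e : mxform N x y = k.
    by rewrite (formC _ _ NT) -form1_mulr.
  have := form_cauchy_schwarz x y NT N0; rewrite e => cs.
  have le : mxform N y y <= s * k.
    by rewrite form_shift lerBlDr lerDl form_gram_ge0.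
  have [->|kn0] := eqVneq k 0; first by rewrite mulr_ge0// ltW.
  have kp : 0 < k by rewrite lt_neqAle eq_sym kn0.
  have : k ^+ 2 <= s * mxform N x x * k.
    by apply: le_trans cs _; rewrite mulrAC mulrC ler_wpM2r.
  by rewrite expr2 ler_pM2r.
have H3 x : norm2 x = 1 -> 1 <= c * s * (s - norm2 (A *m x) ^+ 2).
  move=> x1; have := H1 x; rewrite {1}form1_norm2 x1 expr1n => h.
  apply: le_trans h _; rewrite -mulrA ler_wpM2l//.
  by apply: le_trans (H2 x) _; rewrite form_shift form_gram !form1_norm2 x1 expr1n mulr1.
have cs : 0 < c * s.
  have := H3 _ (norm2_delta R (Ordinal d0)).
  rewrite lt_neqAle eq_sym mulr_ge0 ?(ltW s0)// andbT.
  by case: eqVneq => // ->; rewrite mul0r ler10.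
have H4 x : norm2 x = 1 -> norm2 (A *m x) ^+ 2 <= s - (c * s)^-1.
  move=> /H3; rewrite mulrC -ler_pdivrMr// mul1r; lra.
have ub0 : 0 <= s - (c * s)^-1.
  by apply: le_trans (H4 _ (norm2_delta R (Ordinal d0))); exact: sqr_ge0.
have : spectral_norm A <= Num.sqrt (s - (c * s)^-1).
  apply: spectral_norm_le => // x /H4 h.
  by rewrite -[norm2 _]ger0_norm ?norm2_ge0// -sqrtr_sqr ler_wsqrtr.
rewrite -ler_sqr ?nnegrE ?sqrtr_ge0 ?(ltW sg)// sqr_sqrtr// -/s.
have : 0 < (c * s)^-1 by rewrite invr_gt0.
lra.
Qed.

Variable l1 : R.
Hypotheses (A0 : A != 0) (hl1 : largest_eigenvalue Sig l1).

Lemma sqr_spectral_norm_le : spectral_norm A ^+ 2 <= l1.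
Proof. by case: hl1 => _; apply; exact: spectral_norm_eigenvalue. Qed.

Lemma largest_eigenvalue_gt0 : 0 < l1.
Proof.
by apply: lt_le_trans sqr_spectral_norm_le; rewrite exprn_gt0// spectral_norm_gt0.
Qed.

Lemma rayleigh x : mxform Sig x x <= l1 * mxform 1%:M x x.
Proof.
apply: le_trans (rayleigh_spectral_norm x) _.
by rewrite ler_wpM2r ?form1_ge0 ?sqr_spectral_norm_le.
Qed.

(** [eigenvalue] provides a row vector; symmetry of the Gram matrix lets it be transposed. *)
Lemma top_eigenvector : exists2 v, Sig *m v = l1 *: v & norm2 v = 1.
Proof.
case: hl1 => /eigenvalueP [v hv v0] _.
have vT0 : v^T != 0 by rewrite -trmx0 (inj_eq trmx_inj).
have nv : norm2 v^T != 0 by rewrite norm2_eq0.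
exists ((norm2 v^T)^-1 *: v^T).
  rewrite -scalemxAr scalerA mulrC -scalerA; congr (_ *: _).
  by rewrite -[LHS]trmxK trmx_mul trmxK gram_sym hv linearZ.
by rewrite norm2Z ger0_norm ?invr_ge0 ?norm2_ge0// mulVf.
Qed.

Lemma stable_rank_ge1 : 1 <= stable_rank A.
Proof.
have sg := spectral_norm_gt0 A0.
rewrite ler_pdivlMr ?exprn_gt0// mul1r ler_sqr ?nnegrE ?sqrtr_ge0 ?(ltW sg)//.
apply: spectral_norm_le; first exact: nonzero_dim.
by move=> x x1; have := norm2_mulmx_le A x; rewrite x1 mulr1.
Qed.

Lemma frobenius_div_le_stable_rank : frobenius_norm A ^+ 2 / l1 <= stable_rank A.
Proof.
rewrite ler_wpM2l ?sqr_ge0// lef_pV2 ?posrE ?largest_eigenvalue_gt0//.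
  exact: sqr_spectral_norm_le.
by rewrite exprn_gt0// spectral_norm_gt0.
Qed.

Lemma largest_eigenvalue_le_frobenius : l1 <= frobenius_norm A ^+ 2.
Proof.
have [v hv v1] := top_eigenvector.
have : mxform Sig v v = l1.
  by rewrite -form1_mulr hv formZr form1_norm2 v1 expr1n mulr1.
move=> <-; rewrite form_gram form1_norm2 ler_sqr ?nnegrE ?norm2_ge0 ?sqrtr_ge0//.
by have := norm2_mulmx_le A v; rewrite v1 mulr1.
Qed.

End spectral.

(** * One epoch of SVRG *)

Section svrg.
Variables (R : realType) (n d : nat) (A : 'M[R]_(n, d)) (l1 l : R).
Hypotheses (A0 : A != 0) (hl1 : largest_eigenvalue (A^T *m A) l1) (l1l : l1 < l).
Local Notation Sig := (A^T *m A).
Local Notation B := (l%:M - Sig).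
Local Notation mu := (l - l1).
Local Notation F2 := (frobenius_norm A ^+ 2).
Local Notation S := (2 * (F2 * l1) / mu).
Local Notation eta := (1 / (8 * S)).
Local Notation nn x := (mxform 1%:M x x).
Hypothesis hlm : l * mu <= F2 * l1.
Variable p : 'cV[R]_n.
Hypothesis hp : forall i, p i 0 = nn (row i A)^T / F2.

Let mu0 : 0 < mu. Proof. by rewrite subr_gt0. Qed.
Let l10 : 0 < l1. Proof. exact: largest_eigenvalue_gt0 hl1. Qed.
Let F20 : 0 < F2.
Proof. exact: lt_le_trans l10 (largest_eigenvalue_le_frobenius hl1). Qed.
Let S0 : 0 < S.
Proof. by apply: divr_gt0 mu0; apply: mulr_gt0 => //; exact: mulr_gt0. Qed.
Let eta0 : 0 < eta. Proof. by apply: divr_gt0 => //; exact: mulr_gt0. Qed.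

Lemma shift_sym_gram : B^T = B.
Proof. by apply: shift_sym; exact: gram_sym. Qed.

Lemma shift_coercive x : mu * nn x <= mxform B x x.
Proof. rewrite form_shift; have := rayleigh A0 hl1 x; lra. Qed.

Lemma shift_ge0 x : 0 <= mxform B x x.
Proof. by apply: le_trans (shift_coercive x); rewrite mulr_ge0 ?form1_ge0// ltW. Qed.

Lemma shift_unitmx : B \in unitmx.
Proof.
rewrite -row_free_unit -kermx_eq0; apply/rowV0P => v /sub_kermxP vB.
have h : mxform B v^T v^T = 0 by rewrite /mxform trmxK vB mul0mx mxE.
have := shift_coercive v^T; rewrite h => le.
have : nn v^T == 0 by rewrite eq_le form1_ge0 andbT -(pmulr_rle0 _ mu0).
by rewrite form1_eq0 => /eqP/(congr1 trmx); rewrite trmxK trmx0.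
Qed.

Lemma sampling_ge0 i : 0 <= p i 0.
Proof. by rewrite hp divr_ge0 ?form1_ge0// ltW. Qed.

Lemma sampling_sum1 : \sum_i p i 0 = 1.
Proof.
under eq_bigr do rewrite hp.
by rewrite -mulr_suml -sqr_frobenius_norm divff// gt_eqF.
Qed.

Lemma sampling_eq0 i (z : 'cV[R]_d) : p i 0 = 0 -> (A *m z) i 0 = 0.
Proof.
move=> /eqP; rewrite hp mulf_eq0 invr_eq0 (gt_eqF F20) orbF form1_eq0 => /eqP h.
have r0 : row i A = 0 by rewrite -[LHS]trmxK h trmx0.
rewrite mxE big1// => j _; have : row i A 0 j = 0 by rewrite r0 mxE.
by rewrite mxE => ->; rewrite mul0r.
Qed.

(** An unbiased estimate of [B *m z]: the linear part of the gradient of psi_i, divided by p_i. For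
    a zero row the quotient takes the default value 0, and the row has no weight. *)
Let G i (z : 'cV[R]_d) := l *: z - ((A *m z) i 0 / p i 0) *: (row i A)^T.

Let GB i (z w : 'cV[R]_d) : G i (z - w) = G i z - G i w.
Proof.
rewrite /G; have -> : (A *m (z - w)) i 0 = (A *m z) i 0 - (A *m w) i 0.
  by rewrite mulmxBr mxE [X in _ + X]mxE.
set u := (A *m z) i 0; set u' := (A *m w) i 0.
by apply/colP => j; rewrite !mxE; ring.
Qed.

Let mul_p_div i (z : 'cV[R]_d) : p i 0 * ((A *m z) i 0 / p i 0) = (A *m z) i 0.
Proof.
have [p0|p0] := eqVneq (p i 0) 0; first by rewrite p0 mul0r (sampling_eq0 _ p0).
by rewrite mulrC divfK.
Qed.

Let mean_G (z : 'cV[R]_d) : \sum_i p i 0 *: G i z = B *m z.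
Proof.
rewrite mulmxBl mul_scalar_mx -sum_rows_outer /G.
under eq_bigr do rewrite scalerBr 2!scalerA mul_p_div mulrC -scalerA.
by rewrite big_split /= -scaler_sumr -scaler_suml sampling_sum1 scale1r sumrN.
Qed.

Let form1_row i (z : 'cV[R]_d) : mxform 1%:M z (row i A)^T = (A *m z) i 0.
Proof. by rewrite form1E mxE; apply: eq_bigr => j _; rewrite !mxE mulrC. Qed.

Let second_moment_G z :
  \sum_i p i 0 * nn (G i z) = l ^+ 2 * nn z - 2 * l * mxform Sig z z + F2 * mxform Sig z z.
Proof.
have q : mxform Sig z z = \sum_i (A *m z) i 0 ^+ 2.
  by rewrite form_gram form1_norm2 sqr_norm2.
have E i : p i 0 * nn (G i z) =
    l ^+ 2 * nn z * p i 0 + (F2 - 2 * l) * (A *m z) i 0 ^+ 2.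
  rewrite /G formDl !formDr !formNl !formNr !formZl !formZr.
  rewrite (formC (row i A)^T z (trmx1 _ _)) form1_row.
  have na : nn (row i A)^T = F2 * p i 0 by rewrite hp mulrC divfK// gt_eqF.
  rewrite na; set u := (A *m z) i 0; set a := nn z.
  have [p0|p0] := eqVneq (p i 0) 0.
    by rewrite /u (sampling_eq0 z p0) p0; ring.
  by field.
under eq_bigr do rewrite E.
rewrite big_split /= -!mulr_sumr sampling_sum1 -q; ring.
Qed.

(** Put k = F2 l1 / mu and q = |A z|^2. The second moment equals l <z, B z> - l q + F2 q. Here l <=
    k by [hlm], and F2 q <= F2 l1 |z|^2 = k mu |z|^2 <= k <z, B z>; finally S = 2 k. *)
Let second_moment_G_le z : \sum_i p i 0 * nn (G i z) <= S * mxform B z z.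
Proof.
rewrite second_moment_G.
have q0 := form_gram_ge0 A z; have qr := rayleigh A0 hl1 z.
have c := shift_coercive z; rewrite form_shift in c *.
set q := mxform Sig z z in q0 qr c *; set a := nn z in qr c *.
have E : S * (l * a - q) = 2 * ((F2 * l1) / mu * (l * a - q)) by field; rewrite gt_eqF.
rewrite E; set k := F2 * l1 / mu.
have k1 : l <= k by rewrite ler_pdivlMr.
have l0 : 0 < l by exact: lt_trans l1l.
have k0 : 0 <= k by exact: le_trans (ltW l0) k1.
have c0 : 0 <= l * a - q by apply: le_trans c; rewrite mulr_ge0 ?form1_ge0 ?(ltW mu0).
have h1 : l * (l * a - q) <= k * (l * a - q) by rewrite ler_wpM2r.
have h2 : F2 * q <= k * (l * a - q).
  have : F2 * q <= F2 * (l1 * a) by rewrite ler_wpM2l// ltW.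
  have : k * (mu * a) <= k * (l * a - q) by rewrite ler_wpM2l.
  have -> : k * (mu * a) = F2 * (l1 * a) by rewrite /k; field; rewrite gt_eqF.
  lra.
have : 0 <= l * q by rewrite mulr_ge0// ltW.
nra.
Qed.

(** A variance is at most the second moment, and the mean of [G i z] is [B *m z]. *)
Let centered_second_moment_le z :
  \sum_i p i 0 * nn (G i z - B *m z) <= S * mxform B z z.
Proof.
apply: le_trans (second_moment_G_le z).
have -> : \sum_i p i 0 * nn (G i z - B *m z) =
    \sum_i p i 0 * nn (G i z) - nn (B *m z).
  transitivity (\sum_i (p i 0 * nn (G i z) +
      (- 2 * mxform 1%:M (B *m z) (p i 0 *: G i z) + nn (B *m z) * p i 0))).
    apply: eq_bigr => i _.
    move: (G i z) (B *m z) => u v.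
    rewrite formDl !formDr !formNl !formNr (formC u v (trmx1 _ _)) formZr; ring.
  rewrite big_split /= big_split /= -!mulr_sumr -form_sumr mean_G sampling_sum1.  ring.
by rewrite gerBl form1_ge0.
Qed.

Let nnB_le (u v : 'cV[R]_d) : nn (u - v) <= 2 * nn u + 2 * nn v.
Proof.
have := form1_ge0 (u + v).
rewrite !formDl !formDr !formNl !formNr; lra.
Qed.

Variables (b xs x0 : 'cV[R]_d).
Hypothesis hxs : B *m xs = b.
Let g := l *: x0 - Sig *m x0 - b.

Let gE : g = B *m (x0 - xs).
Proof. by rewrite /g mulmxBr hxs mulmxBl mul_scalar_mx. Qed.

(** The transition operator of one inner step: its k-th iterate applied to [F] is the expectation of
    [F] after k steps, a finite sum without any space of trajectories. *)
Definition svrg_mean (F : 'cV[R]_d -> R) (x : 'cV[R]_d) : R :=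
  \sum_i p i 0 * F (step_val A l eta p x0 g x i).

(** The step direction is G e - (G e0 - B e0), with mean B e. Its squared norm is at most 2 |G e|^2
    + 2 |G e0 - B e0|^2, so the variance is controlled by the errors of [x] and of the anchor
    [x0]. *)
Lemma svrg_step_descent x :
  svrg_mean (fun y => nn (y - xs)) x <=
  nn (x - xs) - 7 / 4 * eta * mxform B (x - xs) (x - xs)
    + eta / 4 * mxform B (x0 - xs) (x0 - xs).
Proof.
set e := x - xs; set e0 := x0 - xs.
have E i : p i 0 * nn (step_val A l eta p x0 g x i - xs) <=
   nn e * p i 0 - 2 * eta * mxform 1%:M e (p i 0 *: (G i e - (G i e0 - B *m e0)))
   + 2 * eta ^+ 2 * (p i 0 * nn (G i e)) + 2 * eta ^+ 2 * (p i 0 * nn (G i e0 - B *m e0)).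
  (* For p_i = 0 the step length eta / p_i is the default 0 and the identity below may fail, but
     both sides carry the weight 0. *)
  have [p0|p0] := eqVneq (p i 0) 0.
    rewrite p0 !mul0r scale0r -[0 : 'cV_d](scale0r e) formZr.
    by rewrite !(mul0r, mulr0) subr0 !addr0.
  have -> : step_val A l eta p x0 g x i - xs = e - eta *: (G i e - (G i e0 - B *m e0)).
    have -> : G i e - (G i e0 - B *m e0) = G i (x - x0) + g.
      rewrite gE -/e0 opprB addrA addrAC -GB; congr (G i _ + _).
      by rewrite /e /e0 opprB addrA subrK.
    rewrite /step_val /G /e; set u := (A *m _) i 0; move: (eta) => et.
    by apply/colP => j; rewrite !mxE; field.
  have := nnB_le (G i e) (G i e0 - B *m e0).
  move: (G i e - (G i e0 - B *m e0)) (nn (G i e)) (nn (G i e0 - B *m e0)).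
  move=> H a1 a2 hH; clearbody e.
  rewrite formZr !formDl !formDr !formNl !formNr !formZl !formZr (formC H e (trmx1 _ _)).
  have pp : 0 <= p i 0 * eta ^+ 2 by rewrite mulr_ge0 ?sqr_ge0 ?sampling_ge0.
  have := ler_wpM2l pp hH; nra.
rewrite /svrg_mean; apply: (le_trans (ler_sum _ (fun i _ => E i))).
rewrite !big_split /= sumrN -!mulr_sumr -form_sumr sampling_sum1 mulr1.
have -> : \sum_i p i 0 *: (G i e - (G i e0 - B *m e0)) = B *m e.
  transitivity (\sum_i (p i 0 *: G i e + (- (p i 0 *: G i e0) + p i 0 *: (B *m e0)))).
    by apply: eq_bigr => i _; rewrite !scalerBr opprB (addrC (- _)).
  rewrite big_split /= big_split /= sumrN !mean_G -scaler_suml.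
  by rewrite sampling_sum1 scale1r addNr addr0.
rewrite form1_mulr.
have h1 := second_moment_G_le e; have h2 := centered_second_moment_le e0.
have e2 : 0 <= 2 * eta ^+ 2 by rewrite mulr_ge0 ?sqr_ge0.
have := ler_wpM2l e2 h1; have := ler_wpM2l e2 h2.
(* The choice eta = 1 / (8 S) makes 2 eta^2 S equal to eta / 4, so the decrease 2 eta is reduced to
   7 / 4 eta. *)
have c u : 2 * eta ^+ 2 * (S * u) = eta / 4 * u.
  by have := lt0r_neq0 S0; move: (S) => s s0; field.
rewrite !c; lra.
Qed.

Let svrg_mean_le F F' x : (forall y, F y <= F' y) -> svrg_mean F x <= svrg_mean F' x.
Proof. by move=> h; apply: ler_sum => i _; rewrite ler_wpM2l ?sampling_ge0. Qed.

Let svrg_mean_affine F F' a c x :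
  svrg_mean (fun y => F y - a * F' y + c) x = svrg_mean F x - a * svrg_mean F' x + c.
Proof.
rewrite /svrg_mean (eq_bigr (fun i => p i 0 * F (step_val A l eta p x0 g x i) +
  (- a * (p i 0 * F' (step_val A l eta p x0 g x i)) + c * p i 0))); last first.
  by move=> i _; ring.
by rewrite big_split /= big_split /= -!mulr_sumr sampling_sum1; ring.
Qed.

Lemma ebound_svrg_step F x :
  ebound (svrg_step A l eta p b x0 g x) F (svrg_mean F x).
Proof.
rewrite /svrg_step.
apply: (@ebound_bind _ _ _ _ _ F (fun i => F (step_val A l eta p x0 g x i))).
  exact: ebound_draw sampling_ge0 sampling_sum1.
move=> i.
apply: runs_ebound (runs_svrg_step_tail _ _ _ _ _ _ _ _ _) _; exact: lexx.
Qed.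

Lemma ebound_svrg_steps k F x :
  ebound (repeatp k (svrg_step A l eta p b x0 g) x) F (iter k svrg_mean F x).
Proof.
elim: k x => [|k IH] x; first exact: ebound_ret.
apply: (@ebound_bind _ _ _ _ _ F (iter k svrg_mean F)) => //.
exact: ebound_svrg_step.
Qed.

Let iter_svrg_mean_descent k x :
  iter k.+1 svrg_mean (fun y => nn (y - xs)) x <=
  iter k svrg_mean (fun y => nn (y - xs)) x
   - 7 / 4 * eta * iter k svrg_mean (fun y => mxform B (y - xs) (y - xs)) x
   + eta / 4 * mxform B (x0 - xs) (x0 - xs).
Proof.
elim: k x => [|k IH] x; first exact: svrg_step_descent.
rewrite iterS; apply: le_trans (svrg_mean_le _ IH) _.
by rewrite svrg_mean_affine.
Qed.

Let iter_svrg_mean_ge0 k F x : (forall y, 0 <= F y) -> 0 <= iter k svrg_mean F x.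
Proof.
move=> F0; elim: k x => [|k IH] x //=.
by apply: sumr_ge0 => i _; rewrite mulr_ge0 ?sampling_ge0.
Qed.

(** The descent inequality telescopes. Summation starts at the first iterate, because the epoch
    never returns its starting point. The induction keeps the final squared distance, which is
    dropped at the end as nonnegative. *)
Lemma svrg_mean_average m x :
  7 / 4 * eta * \sum_(k < m) iter k.+1 svrg_mean (fun y => mxform B (y - xs) (y - xs)) x <=
  iter 1 svrg_mean (fun y => nn (y - xs)) x
    + m%:R * (eta / 4 * mxform B (x0 - xs) (x0 - xs)).
Proof.
have H : iter m.+1 svrg_mean (fun y => nn (y - xs)) x +
  7 / 4 * eta * \sum_(k < m) iter k.+1 svrg_mean (fun y => mxform B (y - xs) (y - xs)) x <=
  iter 1 svrg_mean (fun y => nn (y - xs)) x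
    + m%:R * (eta / 4 * mxform B (x0 - xs) (x0 - xs)).
  elim: m => [|m IH]; first by rewrite big_ord0 mulr0 mul0r !addr0.
  have := iter_svrg_mean_descent m.+1 x.
  rewrite big_ord_recr /= -natr1 in IH *; nra.
apply: le_trans H; rewrite lerDr; apply: iter_svrg_mean_ge0 => y; exact: form1_ge0.
Qed.

Variable M : nat.
Hypothesis hM : 64 * S / mu <= M%:R.

(** The size of [M] gives eta mu M >= 8, so coercivity bounds |x0 - xs|^2 by eta M / 8 times the
    initial error f0. The mean error is then at most (1/8 + 1/4) / (7/4) = 3/14 of f0, well below
    one half. *)
Lemma ebound_svrg_epoch :
  ebound (svrg_epoch A l eta M p b x0) (fun y => mxform B (y - xs) (y - xs))
    (1 / 2 * mxform B (x0 - xs) (x0 - xs)).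
Proof.
have M0 : 0 < M%:R :> R.
  by apply: lt_le_trans hM; rewrite divr_gt0// mulr_gt0.
pose F y := mxform B (y - xs) (y - xs).
apply: ebound_runs (runs_grad_f _ _ _ _) _; rewrite -/g.
apply: (@ebound_runs _ _ _ _ _ (1 / M%:R) 1) => //.
apply: (@ebound_le _ _ _ _ (\sum_(k < M) 1 / M%:R * iter k.+1 svrg_mean F x0)); last first.
  apply: (@ebound_bind _ _ _ _ _ F (fun k : 'I_M => iter k.+1 svrg_mean F x0)).
    apply: ebound_draw; first by move=> _; rewrite divr_ge0// ltW.
    by rewrite sumr_const card_ord -mulrnAl divff// gt_eqF.
  by move=> k; exact: ebound_svrg_steps.
rewrite -mulr_sumr; set Z := \sum_(k < M) _.
have := svrg_mean_average M x0; rewrite -/F -/Z => hZ.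
(* At the anchor both B-terms coincide and add up to -3/2 eta f0, so the first step does not
   increase the expected squared distance. *)
have h1 : iter 1 svrg_mean (fun y => nn (y - xs)) x0 <= nn (x0 - xs).
  apply: le_trans (svrg_step_descent x0) _.
  have : 0 <= eta * mxform B (x0 - xs) (x0 - xs) by rewrite mulr_ge0 ?shift_ge0 ?(ltW eta0).
  lra.
have c := shift_coercive (x0 - xs).
set f0 := mxform B (x0 - xs) (x0 - xs) in hZ c *.
have f00 : 0 <= f0 by exact: shift_ge0.
set a := nn (x0 - xs) in h1 c; set i1 := iter 1 _ _ _ in hZ h1.
have hm : 8 <= eta * mu * M%:R.
  have : eta * mu * (64 * S / mu) <= eta * mu * M%:R.
    by rewrite ler_wpM2l// mulr_ge0 ?(ltW eta0) ?(ltW mu0).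
  have -> : eta * mu * (64 * S / mu) = 8.
    have m0 := lt0r_neq0 mu0; have := lt0r_neq0 S0; move: (S) => s s0.
    by field; rewrite m0.
  done.
rewrite mul1r mulrC ler_pdivrMr//.
have aM : 8 * a <= eta * M%:R * f0.
  have : 8 * a <= eta * mu * M%:R * a by rewrite ler_wpM2r ?form1_ge0.
  have : eta * M%:R * (mu * a) <= eta * M%:R * f0.
    by rewrite ler_wpM2l// mulr_ge0 ?(ltW eta0) ?(ltW M0).
  lra.
rewrite -(ler_pM2l eta0).
have : 0 <= eta * M%:R * f0.
  by apply: mulr_ge0 f00; apply: mulr_ge0 (ltW M0); exact: ltW.
lra.
Qed.

End svrg.

(** * Geometric convergence of repeated epochs *)

Section svrg_solve.
Variables (R : realType) (n d : nat) (A : 'M[R]_(n, d)) (l1 l : R).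
Hypotheses (A0 : A != 0) (hl1 : largest_eigenvalue (A^T *m A) l1) (l1l : l1 < l).
Local Notation B := (l%:M - A^T *m A).
Local Notation S := (2 * (frobenius_norm A ^+ 2 * l1) / (l - l1)).
Hypothesis hlm : l * (l - l1) <= frobenius_norm A ^+ 2 * l1.
Variable p : 'cV[R]_n.
Hypothesis hp : forall i,
  p i 0 = mxform 1%:M (row i A)^T (row i A)^T / frobenius_norm A ^+ 2.
Variable M : nat.
Hypothesis hM : 64 * S / (l - l1) <= M%:R.

(** Starting from 0 makes the initial error the solution itself, so the bound is a relative one. *)
Lemma ebound_svrg_solve K (b xs : 'cV[R]_d) : B *m xs = b ->
  ebound (svrg_solve A l (1 / (8 * S)) M p K b)
    (fun y => mxform B (y - xs) (y - xs)) ((1 / 2) ^+ K * mxform B xs xs).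
Proof.
move=> hxs.
have -> : mxform B xs xs = mxform B (0 - xs) (0 - xs).
  by rewrite sub0r formNl formNr opprK.
rewrite /svrg_solve; elim: K (0 : 'cV_d) => [|K IH] x.
  by apply: ebound_ret; rewrite expr0 mul1r.
apply: ebound_bind (IH).
have -> : (1 / 2) ^+ K.+1 * mxform B (x - xs) (x - xs) =
   0 + (1 / 2) ^+ K * (1 / 2 * mxform B (x - xs) (x - xs)) by rewrite exprSr; ring.
apply: ebound_affine (ebound_svrg_epoch A0 hl1 l1l hlm hp x hxs hM).
  by rewrite exprn_ge0// divr_ge0.
by move=> y; rewrite add0r.
Qed.

End svrg_solve.

(** * Perturbation of the ratios a / w and a / m *)

Section noisy_step.
Variable R : realType.

(** For 0 <= k <= 1/3 one has (1 + k) / (1 - k) <= 1 + 3 k. *)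
Lemma noise_ratio (a a' w w' k c : R) : 0 <= k <= 1 / 3 -> 0 <= c -> 0 <= w' ->
  a' <= (1 + k) * a -> (1 - k) * w <= w' -> a <= c * w -> a' <= (1 + 3 * k) * c * w'.
Proof.
move=> /andP[k0 k1] c0 w0 ha hw hc.
have h1 : (1 + k) * a <= (1 + k) * (c * w) by rewrite ler_wpM2l//; lra.
have h2 : (1 + 3 * k) * c * ((1 - k) * w) <= (1 + 3 * k) * c * w'.
  by rewrite ler_wpM2l// mulr_ge0//; lra.
have [wn|wp] := leP w 0.
  have : c * w <= 0 by rewrite mulr_ge0_le0.
  have : 0 <= (1 + 3 * k) * c * w' by rewrite !mulr_ge0//; lra.
  nra.
have cw : 0 <= c * w by rewrite mulr_ge0// ltW.
have : (1 + k) * (c * w) <= (1 + 3 * k) * (1 - k) * (c * w).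
  rewrite ler_wpM2r//; nra.
lra.
Qed.

(** Here [s] is the noise allowance already spent and [u] that of the current step. As a <= 2 Psi w,
    the error [e] is at most k w with k = u / 12, hence also at most k m and k a; each ratio grows
    by at most 1 + 3 k = 1 + u / 4, which the increase from 1 + s to 1 + s + u absorbs. *)
Lemma noisy_ratios (Psi s u a w m e a' w' m' : R) t :
  1 <= Psi -> 0 <= s -> 0 < u -> s + u <= 1 -> 0 < w -> w <= m -> m <= a ->
  a <= Psi * (1 + s) * w ->
  4 ^+ t * (5 * a) <= Psi * w \/ a <= 5 * (1 + s) * m ->
  e <= u / (24 * Psi) * a -> a' <= a + e -> w - e <= w' -> m - e <= m' -> w' <= m' ->
  [/\ 0 < w', a' <= Psi * (1 + (s + u)) * w' &
      4 ^+ t.+1 * a' <= Psi * w' \/ a' <= 5 * (1 + (s + u)) * m'].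
Proof.
move=> P1 s0 u0 su w0 wm ma haw alt he ha' hw' hm' wm'.
pose k := u / 12.
have k0 : 0 < k by rewrite /k; lra.
have k12 : k <= 1 / 12 by rewrite /k; lra.
have kk : 0 <= k <= 1 / 3 by apply/andP; split; lra.
have P0 : 0 < Psi by lra.
have ek : e <= k * w.
  apply: le_trans he _; have h : a <= 2 * Psi * w.
    by apply: le_trans haw _; rewrite ler_pM2r// mulrC ler_pM2r//; lra.
  have : u / (24 * Psi) * a <= u / (24 * Psi) * (2 * Psi * w).
    by rewrite ler_pM2l// divr_gt0// mulr_gt0.
  have -> // : u / (24 * Psi) * (2 * Psi * w) = k * w.
  by rewrite /k; field; rewrite gt_eqF.
have kw : k * w <= k * m by rewrite ler_pM2l.
have km : k * m <= k * a by rewrite ler_pM2l.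
have hw : (1 - k) * w <= w' by lra.
have hm : (1 - k) * m <= m' by lra.
have ha : a' <= (1 + k) * a by lra.
have w'0 : 0 < w' by apply: lt_le_trans hw; rewrite mulr_gt0//; lra.
have m'0 : 0 < m' by exact: lt_le_trans wm'.
have grow : (1 + 3 * k) * (1 + s) <= 1 + (s + u).
  have : u * s <= u by rewrite ler_piMr//; lra.
  by rewrite /k; lra.
split=> //.
  have c0 : 0 <= Psi * (1 + s) by rewrite mulr_ge0//; lra.
  apply: le_trans (noise_ratio kk c0 (ltW w'0) ha hw haw) _.
  by rewrite ler_pM2r// mulrCA ler_pM2l.
case: alt => [drop|stay]; [left|right]; last first.
  have c0 : 0 <= 5 * (1 + s) by lra.
  apply: le_trans (noise_ratio kk c0 (ltW m'0) ha hm stay) _.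
  by rewrite ler_pM2r// mulrCA ler_pM2l.
have f0 : (0 : R) < 4 ^+ t by rewrite exprn_gt0.
have f5 : (0 : R) < 4 ^+ t * 5 by rewrite mulr_gt0.
have c0 : 0 <= Psi / (4 ^+ t * 5) by rewrite divr_ge0// ltW.
have hc : a <= Psi / (4 ^+ t * 5) * w.
  by rewrite mulrAC ler_pdivlMr// mulrC -mulrA.
have h := noise_ratio kk c0 (ltW w'0) ha hw hc.
have f4 : (0 : R) < 4 ^+ t.+1 by rewrite exprn_gt0.
rewrite -(ler_pM2l f4) in h; apply: le_trans h _.
(* An exact step gains a factor 5 and only 4 is claimed: the noise factor satisfies 1 + 3 k <= 5/4
   because k <= 1/12. *)
have -> : 4 ^+ t.+1 * ((1 + 3 * k) * (Psi / (4 ^+ t * 5)) * w') =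
    (4 / 5 * (1 + 3 * k)) * (Psi * w').
  by rewrite exprS; field; rewrite gt_eqF.
by rewrite ler_piMl//; [rewrite mulr_ge0// ltW|lra].
Qed.

End noisy_step.

(** * One inexact power iteration *)

Section power.
Variables (R : realType) (n d : nat) (A : 'M[R]_(n, d)) (l1 l : R).
Hypotheses (A0 : A != 0) (hl1 : largest_eigenvalue (A^T *m A) l1) (l1l : l1 < l).
Local Notation Sig := (A^T *m A).
Local Notation B := (l%:M - Sig).
Local Notation mu := (l - l1).
Variable v : 'cV[R]_d.
Hypotheses (hv : Sig *m v = l1 *: v) (v1 : norm2 v = 1).

Let mu0 : 0 < mu. Proof. by rewrite subr_gt0. Qed.
Let smu0 : 0 < Num.sqrt mu. Proof. by rewrite sqrtr_gt0. Qed.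
Let smu2 : Num.sqrt mu ^+ 2 = mu. Proof. by rewrite sqr_sqrtr// ltW. Qed.
Let BT : B^T = B. Proof. exact: shift_sym_gram. Qed.
Let B0 x : 0 <= mxform B x x. Proof. exact: (shift_ge0 A0 hl1 l1l). Qed.

(** [bnorm], [mnorm] and [vcomp] are a, m and w; the common factor sqrt mu is what orders them as w
    <= m <= a. *)
Definition bnorm x : R := Num.sqrt (mxform B x x).
Definition mnorm (x : 'cV[R]_d) : R := Num.sqrt mu * norm2 x.
Definition vcomp (x : 'cV[R]_d) : R := Num.sqrt mu * `|mxform 1%:M v x|.

Lemma bnorm_ge0 x : 0 <= bnorm x. Proof. exact: sqrtr_ge0. Qed.
Lemma sqr_bnorm x : bnorm x ^+ 2 = mxform B x x. Proof. by rewrite sqr_sqrtr. Qed.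

Let bge0 x : 0 <= bnorm x. Proof. exact: bnorm_ge0. Qed.

Let cs_euclid (x y : 'cV[R]_d) : `|mxform 1%:M x y| <= norm2 x * norm2 y.
Proof.
rewrite -ler_sqr ?nnegrE ?normr_ge0 ?mulr_ge0 ?norm2_ge0// real_normK ?num_real//.
rewrite exprMn -!form1_norm2; apply: form_cauchy_schwarz; [exact: trmx1|exact: form1_ge0].
Qed.

Let cs_shift x y : `|mxform B x y| <= bnorm x * bnorm y.
Proof.
rewrite -ler_sqr ?nnegrE ?normr_ge0 ?mulr_ge0// real_normK ?num_real//.
by rewrite exprMn !sqr_bnorm; exact: form_cauchy_schwarz.
Qed.

Lemma bnormD x y : bnorm (x + y) <= bnorm x + bnorm y.
Proof.
rewrite -ler_sqr ?nnegrE ?addr_ge0// sqrrD !sqr_bnorm formDl !formDr.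
rewrite (formC y x BT); have := cs_shift x y; have := ler_norm (mxform B x y); lra.
Qed.

Lemma mnorm_le_bnorm x : mnorm x <= bnorm x.
Proof.
rewrite -ler_sqr ?nnegrE ?mulr_ge0 ?norm2_ge0 ?(ltW smu0)//.
rewrite exprMn smu2 -form1_norm2 sqr_bnorm.
exact: shift_coercive.
Qed.

Lemma vcomp_le_mnorm x : vcomp x <= mnorm x.
Proof. by rewrite ler_pM2l//; have := cs_euclid v x; rewrite v1 mul1r. Qed.

(** Since w <= m <= a, an error bounded in the B-norm alone perturbs all three quantities by no more
    than that bound. *)
Lemma vcompD x y : vcomp x - bnorm y <= vcomp (x + y).
Proof.
have := le_trans (vcomp_le_mnorm y) (mnorm_le_bnorm y).
rewrite /vcomp formDr => h.
have := lerB_normD (mxform 1%:M v x) (mxform 1%:M v y).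
rewrite -(ler_pM2l smu0) mulrBr; lra.
Qed.

Lemma mnormD x y : mnorm x - bnorm y <= mnorm (x + y).
Proof.
have h := mnorm_le_bnorm y.
have tri : norm2 x <= norm2 (x + y) + norm2 y.
  have -> : norm2 y = norm2 (- y) by rewrite -scaleN1r norm2Z normrN1 mul1r.
  rewrite -{1}[x](addrK y); move: (x + y) (- y) => a b.
  rewrite -ler_sqr ?nnegrE ?addr_ge0 ?norm2_ge0// sqrrD -!form1_norm2 formDl !formDr.
  rewrite (formC b a (trmx1 _ _)); have := cs_euclid a b.
  have := ler_norm (mxform 1%:M a b); lra.
rewrite -(ler_pM2l smu0) mulrDr in tri; rewrite /mnorm in h *; lra.
Qed.

Section exact_step.
Variables (x y : 'cV[R]_d).
Hypothesis hy : B *m y = x.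

(** From B y = x one gets |y|_B^2 = <y, x>; the bounds on a after an exact step all start here. *)
Let bnorm_sqr_le : mu * bnorm y ^+ 2 <= mnorm y * mnorm x.
Proof.
rewrite sqr_bnorm -form1_mulr hy /mnorm mulrACA -expr2 smu2 ler_pM2l//.
by apply: le_trans (ler_norm _) _; exact: cs_euclid.
Qed.

(** [v] is an eigenvector of the symmetric matrix B for mu, so B multiplies the component along [v]
    by mu. *)
Lemma vcomp_exact : vcomp x = mu * vcomp y.
Proof.
rewrite /vcomp; have -> : mxform 1%:M v x = mu * mxform 1%:M v y.
  rewrite -hy form1_mulr (formC _ _ BT) -form1_mulr.
  by rewrite mulmxBl mul_scalar_mx hv -scalerBl formZr (formC y v (trmx1 _ _)).
by rewrite normrM gtr0_norm// mulrCA.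
Qed.

Lemma bnorm_exact : mu * bnorm y <= bnorm x.
Proof.
have h := bnorm_sqr_le; have [->|y0] := eqVneq (bnorm y) 0; first by rewrite mulr0.
have yp : 0 < bnorm y by rewrite lt_neqAle eq_sym y0 bnorm_ge0.
rewrite -(ler_pM2r yp).
have := ler_pM (mulr_ge0 (ltW smu0) (norm2_ge0 y)) (mulr_ge0 (ltW smu0) (norm2_ge0 x))
  (mnorm_le_bnorm y) (mnorm_le_bnorm x).
rewrite /mnorm in h *; lra.
Qed.

Lemma bnorm_exact_far : 5 * mnorm y < bnorm y -> 5 * (mu * bnorm y) <= bnorm x.
Proof.
move=> far; have h := bnorm_sqr_le.
have my0 : 0 <= mnorm y by rewrite mulr_ge0 ?norm2_ge0 ?(ltW smu0).
have mx0 : 0 <= mnorm x by rewrite mulr_ge0 ?norm2_ge0 ?(ltW smu0).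
have yp : 0 < bnorm y by lra.
apply: le_trans (mnorm_le_bnorm x); rewrite -(ler_pM2r yp).
have : 5 * mnorm y * mnorm x <= bnorm y * mnorm x by rewrite ler_wpM2r// ltW.
lra.
Qed.

(** Cauchy-Schwarz is used twice: m(x)^2 = mu <x, y>_B <= mu a(x) a(y) gives m(x) <= mu r a(y),
    which is inserted into mu a(y)^2 <= m(y) m(x). *)
Lemma ratio_exact r : 0 <= r -> bnorm x <= r * mnorm x -> bnorm y <= r * mnorm y.
Proof.
move=> r0 hr; have h := bnorm_sqr_le.
have my0 : 0 <= mnorm y by rewrite mulr_ge0 ?norm2_ge0 ?(ltW smu0).
have [->|y0] := eqVneq (bnorm y) 0; first by rewrite mulr_ge0.
have yp : 0 < bnorm y by rewrite lt_neqAle eq_sym y0 bnorm_ge0.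
have mx : mnorm x <= mu * r * bnorm y.
  have [->|x0] := eqVneq (mnorm x) 0; first by rewrite !mulr_ge0 ?(ltW mu0).
  have xp : 0 < mnorm x by rewrite lt_neqAle eq_sym x0 mulr_ge0 ?norm2_ge0 ?(ltW smu0).
  rewrite -(ler_pM2r xp).
  have : mnorm x ^+ 2 <= mu * (bnorm x * bnorm y).
    rewrite exprMn smu2 ler_pM2l// -form1_norm2 -{2}hy form1_mulr.
    by apply: le_trans (ler_norm _) _; exact: cs_shift.
  have : mu * (bnorm x * bnorm y) <= mu * (r * mnorm x * bnorm y).
    by rewrite ler_pM2l// ler_pM2r.
  lra.
have h' : mnorm y * mnorm x <= mnorm y * (mu * r * bnorm y) by rewrite ler_wpM2l.
rewrite -(ler_pM2r yp) -(ler_pM2l mu0); lra.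
Qed.

End exact_step.

(** Either a / w has fallen by a factor 4 in every step so far, or a / m is small and remains so.
    The factor 1 + t / T, at most 2, is the accumulated effect of solver errors; the third clause
    keeps w large enough for the next error to be harmless. *)
Definition power_inv (Psi : R) (T t : nat) (x : 'cV[R]_d) : Prop :=
  [/\ norm2 x = 1, 0 < vcomp x, bnorm x <= Psi * (1 + t%:R / T%:R) * vcomp x &
      4 ^+ t * bnorm x <= Psi * vcomp x \/
      bnorm x <= 5 * (1 + t%:R / T%:R) * mnorm x].

Let unitv_scale (x : 'cV[R]_d) : 0 < vcomp x -> exists2 q : R, 0 < q &
  [/\ bnorm (unitv x) = q * bnorm x, vcomp (unitv x) = q * vcomp x &
      mnorm (unitv x) = q * mnorm x].
Proof.
move=> w0; have xn0 : x != 0.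
  apply/eqP => x0; move: w0; rewrite x0 /vcomp -(scale0r v) formZr mul0r normr0 mulr0.
  by rewrite ltxx.
have q0 : 0 < (norm2 x)^-1.
  by rewrite invr_gt0 lt_neqAle eq_sym norm2_eq0 xn0 norm2_ge0.
exists (norm2 x)^-1 => //; rewrite /unitv (negbTE xn0); split.
- by rewrite /bnorm formZl formZr mulrA -expr2 sqrtrM ?sqr_ge0// sqrtr_sqr gtr0_norm.
- by rewrite /vcomp formZr normrM gtr0_norm// mulrCA.
- by rewrite /mnorm norm2Z gtr0_norm// mulrCA.
Qed.

Lemma power_inv_step Psi T t (x y xi : 'cV[R]_d) : 1 <= Psi -> (t < T)%N ->
  B *m y = x -> bnorm xi <= (24 * T%:R * Psi)^-1 * bnorm y ->
  power_inv Psi T t x -> power_inv Psi T t.+1 (unitv (y + xi)).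
Proof.
move=> P1 tT hy hxi [x1 wx hx alt].
have T0 : 0 < T%:R :> R by rewrite ltr0n; exact: leq_ltn_trans tT.
have u0 : 0 < T%:R^-1 :> R by rewrite invr_gt0.
have s0 : 0 <= t%:R / T%:R :> R by rewrite divr_ge0.
have su : t%:R / T%:R + T%:R^-1 <= 1 :> R.
  by rewrite -[X in _ + X]mul1r -mulrDl ler_pdivrMr// mul1r natr1 ler_nat.
have sE : t.+1%:R / T%:R = t%:R / T%:R + T%:R^-1 :> R.
  by rewrite -natr1 mulrDl mul1r.
have wy := vcomp_exact hy.
have wy0 : 0 < vcomp y by rewrite wy pmulr_rgt0 in wx.
have hyw : bnorm y <= Psi * (1 + t%:R / T%:R) * vcomp y.
  by rewrite -(ler_pM2l mu0) mulrCA -wy; exact: le_trans (bnorm_exact hy) _.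
have alt' : 4 ^+ t * (5 * bnorm y) <= Psi * vcomp y \/
    bnorm y <= 5 * (1 + t%:R / T%:R) * mnorm y.
  (* The distinction concerns the new vector [y]. If it is close, the second alternative starts
     afresh; if it is far, a first alternative at [x] gains the factor 5 and a second one is
     inherited. *)
  have [close|far] := leP (bnorm y) (5 * mnorm y).
    right; apply: le_trans close _.
    rewrite -[leRHS]mulrA ler_pM2l// ler_peMl ?lerDl//.
    by rewrite mulr_ge0 ?norm2_ge0 ?(ltW smu0).
  case: alt => [drop|stay]; [left|right]; last first.
    by apply: (ratio_exact hy) stay; rewrite mulr_ge0// addr_ge0.
  rewrite -(ler_pM2l mu0) [mu * (Psi * _)]mulrCA -wy; apply: le_trans drop.
  rewrite mulrCA ler_pM2l ?exprn_gt0// mulrCA; exact: bnorm_exact_far.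
have hxi' : bnorm xi <= T%:R^-1 / (24 * Psi) * bnorm y.
  by apply: le_trans hxi _; rewrite -invfM mulrCA mulrA.
have [w0 hw halt] := noisy_ratios P1 s0 u0 su wy0 (vcomp_le_mnorm y)
  (mnorm_le_bnorm y) hyw alt' hxi' (bnormD y xi) (vcompD y xi) (mnormD y xi)
  (vcomp_le_mnorm (y + xi)).
have [q q0 [qb qw qm]] := unitv_scale w0.
rewrite /power_inv qb qw qm sE; split.
- exact: norm2_unitv (nonzero_dim A0).
- by rewrite mulr_gt0.
- by rewrite mulrCA ler_pM2l.
case: halt => h; [left|right; by rewrite [X in _ <= X]mulrCA ler_pM2l].
by rewrite [X in X <= _]mulrCA [X in _ <= X]mulrCA ler_pM2l.
Qed.

(** It rests on |x|_B^2 <= l |x|^2, so a lower bound on the component along [v] and an upper bound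
    on the norm control a / w. *)
Lemma power_inv_init Psi T (x : 'cV[R]_d) (c s : R) : 0 < Psi -> 0 < c ->
  c <= `|mxform 1%:M v x| -> norm2 x ^+ 2 <= s -> l * s <= Psi ^+ 2 * mu * c ^+ 2 ->
  power_inv Psi T 0 (unitv x).
Proof.
move=> P0 c0 hc hs hP.
have d0 := nonzero_dim A0.
have l0 : 0 < l by exact: lt_trans (largest_eigenvalue_gt0 A0 hl1) l1l.
have w0 : 0 < vcomp x by rewrite mulr_gt0//; exact: lt_le_trans hc.
have hb : bnorm x <= Psi * vcomp x.
  rewrite -ler_sqr ?nnegrE ?mulr_ge0 ?(ltW w0) ?(ltW P0)// sqr_bnorm.
  rewrite 2!exprMn smu2 form_shift form1_norm2.
  have := form_gram_ge0 A x.
  have : l * norm2 x ^+ 2 <= l * s by rewrite ler_pM2l.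
  have : Psi ^+ 2 * (mu * c ^+ 2) <= Psi ^+ 2 * (mu * `|mxform 1%:M v x| ^+ 2).
    rewrite ler_pM2l ?exprn_gt0// ler_pM2l// ler_sqr ?nnegrE ?normr_ge0//.
    exact: ltW.
  lra.
have [q q0 [qb qw _]] := unitv_scale w0.
have hb' : bnorm (unitv x) <= Psi * vcomp (unitv x).
  by rewrite qb qw mulrCA ler_pM2l.
split.
- exact: norm2_unitv.
- by rewrite qw mulr_gt0.
- by rewrite mul0r addr0 mulr1.
by left; rewrite expr0 mul1r.
Qed.

(** At t = T the first alternative would give 4^T a <= Psi w <= Psi a < 4^T a. Hence a <= 10 m, that
    is l - x^T A^T A x <= 100 mu. *)
Lemma power_inv_final Psi T (x : 'cV[R]_d) : 0 <= Psi -> Psi < 4 ^+ T -> (0 < T)%N ->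
  power_inv Psi T T x -> l1 - 99 * mu <= quad_form Sig x.
Proof.
move=> P0 P4 T0 [x1 w0 _ alt].
have wm := vcomp_le_mnorm x; have mb := mnorm_le_bnorm x.
have T0' : T%:R != 0 :> R by rewrite pnatr_eq0 -lt0n.
have h : bnorm x <= 10 * mnorm x.
  case: alt => [h|]; last by rewrite divff// => h; lra.
  have : Psi * vcomp x <= Psi * bnorm x by rewrite ler_wpM2l//; lra.
  have : Psi * bnorm x < 4 ^+ T * bnorm x by rewrite ltr_pM2r//; lra.
  lra.
have : mxform B x x <= 100 * mu.
  rewrite -sqr_bnorm.
  have : bnorm x ^+ 2 <= (10 * mnorm x) ^+ 2.
    rewrite ler_sqr ?nnegrE//; apply: mulr_ge0 => //; lra.
  by rewrite exprMn /mnorm x1 mulr1 smu2 -natrX.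
rewrite form_shift form1_norm2 x1 expr1n mulr1 /mxform /quad_form; lra.
Qed.

Lemma power_inv_neq0 Psi T t x : power_inv Psi T t x -> x != 0.
Proof.
by move=> [x1 _ _ _]; rewrite -norm2_eq0 x1 oner_eq0.
Qed.

End power.

(** * Failure probability of the power loop *)

Section power_loop.
Variables (R : realType) (n d : nat) (A : 'M[R]_(n, d)) (l1 l : R).
Hypotheses (A0 : A != 0) (hl1 : largest_eigenvalue (A^T *m A) l1) (l1l : l1 < l).
Local Notation Sig := (A^T *m A).
Local Notation B := (l%:M - Sig).
Local Notation mu := (l - l1).
Variable v : 'cV[R]_d.
Hypotheses (hv : Sig *m v = l1 *: v) (v1 : norm2 v = 1).
Let mu0 : 0 < mu. Proof. by rewrite subr_gt0. Qed.
Hypothesis hlm : l * mu <= frobenius_norm A ^+ 2 * l1.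
Variable p : 'cV[R]_n.
Hypothesis hp : forall i,
  p i 0 = mxform 1%:M (row i A)^T (row i A)^T / frobenius_norm A ^+ 2.
Local Notation S := (2 * (frobenius_norm A ^+ 2 * l1) / mu).
Variable M : nat.
Hypothesis hM : 64 * S / mu <= M%:R.
Variables (K T : nat) (Psi : R).
Hypothesis P1 : 1 <= Psi.

Local Notation body :=
  (fun x => y <-- svrg_solve A l (1 / (8 * S)) M p K x ;; normalizep y).
Local Notation bad t := (fun x => (~~ `[< power_inv A l1 l v Psi T t x >])%:R : R).
Local Notation err := ((1 / 2) ^+ K * (24 * T%:R * Psi) ^+ 2).

(** Markov's inequality for the squared error: the invariant can fail only if |z - y|_B^2 exceeds
    |y|_B^2 / (24 T Psi)^2, while its mean is at most 2^-K |y|_B^2. *)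
Lemma ebound_power_step t x : (t < T)%N -> power_inv A l1 l v Psi T t x ->
  ebound (body x) (bad t.+1) err.
Proof.
move=> tT hx.
have T0 : 0 < T%:R :> R by rewrite ltr0n; exact: leq_ltn_trans tT.
pose y := invmx B *m x.
have hy : B *m y = x by rewrite mulKVmx//; exact: shift_unitmx hl1 l1l.
have y0 : y != 0.
  by apply: contra (power_inv_neq0 hx) => /eqP h; rewrite -hy h mulmx0.
have fy : 0 < mxform B y y.
  apply: lt_le_trans (shift_coercive l A0 hl1 y); rewrite mulr_gt0//.
  by rewrite lt_neqAle eq_sym form1_eq0 y0 form1_ge0.
have D0 : 0 < 24 * T%:R * Psi by apply: mulr_gt0 (lt_le_trans ltr01 P1); exact: mulr_gt0.
pose c := (24 * T%:R * Psi) ^+ 2 / mxform B y y.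
have -> : err = 0 + c * ((1 / 2) ^+ K * mxform B y y).
  by rewrite /c; field; rewrite gt_eqF.
have H : forall z, bad t.+1 (unitv z) <= 0 + c * mxform B (z - y) (z - y).
  move=> z; rewrite add0r; case: asboolP => hz /=.
    by apply: mulr_ge0 (shift_ge0 A0 hl1 l1l _); rewrite /c divr_ge0 ?sqr_ge0 ?(ltW fy).
  rewrite leNgt; apply/negP => lt1; apply: hz.
  rewrite -(subrK y z) addrC; apply: power_inv_step hx => //.
  rewrite -ler_sqr ?nnegrE ?mulr_ge0 ?invr_ge0 ?(ltW D0) ?bnorm_ge0//.
  rewrite exprMn !(sqr_bnorm A0 hl1 l1l) exprVn.
  rewrite ler_pdivlMl ?exprn_gt0//; move: lt1.
  by rewrite /c mulrAC ltr_pdivrMr// mul1r => /ltW.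
apply: (@ebound_bind _ _ _ _ _ _ (fun z => bad t.+1 (unitv z))).
  apply: ebound_affine H _; first by rewrite divr_ge0 ?sqr_ge0 ?(ltW fy).
  exact: ebound_svrg_solve.
move=> z; exact: runs_ebound (runs_normalizep z) (lexx _).
Qed.

(** A bound of 0 for the function 0 says that no probability mass is lost, from any starting point.
    It is needed on branches where the invariant has already failed. *)
Lemma ebound_power_body x : ebound (body x) (fun=> 0) 0.
Proof.
apply: (@ebound_le _ _ _ _
  (0 + 0 * ((1 / 2) ^+ K * mxform B (invmx B *m x) (invmx B *m x)))).
  by rewrite mul0r addr0.
apply: (@ebound_bind _ _ _ _ _ _ (fun=> 0)); last first.
  by move=> z; exact: runs_ebound (runs_normalizep z) (lexx _).
apply: ebound_affine (ebound_svrg_solve A0 hl1 l1l hlm hp hM K _) => //.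
  by move=> z; rewrite mul0r addr0.
by rewrite mulKVmx//; exact: shift_unitmx hl1 l1l.
Qed.

Lemma ebound_power_loop_triv k x : ebound (repeatp k body x) (fun=> 0) 0.
Proof.
elim: k x => [|k IH] x; first exact: ebound_ret.
exact: (@ebound_bind _ _ _ _ _ _ (fun=> 0) _ (ebound_power_body x)).
Qed.

(** A union bound over the remaining steps; a state that violates the invariant is charged the full
    failure probability 1. *)
Lemma ebound_power_loop k t x : (t + k = T)%N -> power_inv A l1 l v Psi T t x ->
  ebound (repeatp k body x) (bad T) (k%:R * err).
Proof.
elim: k t x => [|k IH] t x tk hx.
  rewrite addn0 in tk; rewrite mul0r; apply: ebound_ret.
  by rewrite -{2}tk; case: asboolP.
have e0 : 0 <= err by rewrite mulr_ge0 ?sqr_ge0// exprn_ge0// divr_ge0.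
have -> : k.+1%:R * err = k%:R * err + 1 * err by rewrite -natr1; ring.
apply: (@ebound_bind _ _ _ _ _ _ (fun z => k%:R * err + 1 * bad t.+1 z)).
  apply: ebound_affine (ebound_power_step _ hx) => //; lia.
move=> z; case: (boolP `[< power_inv A l1 l v Psi T t.+1 z >]) => [/asboolP hz|hz] /=.
  by rewrite mulr0 addr0; apply: (IH t.+1) hz; lia.
have -> : k%:R * err + 1 * 1 = (k%:R * err + 1) + 0 * 0 by ring.
apply: ebound_affine (ebound_power_loop_triv k z) => // z'.
rewrite mulr0 addr0; have : 0 <= k%:R * err by rewrite mulr_ge0.
by case: asboolP => _ /=; lra.
Qed.

End power_loop.

(** * The Gaussian starting vector *)

Section gaussian_start.
Variable R : realType.

Lemma ebound_gauss (F : R -> R) b : (forall z, 0 <= F z) -> measurable_fun setT F ->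
  (\int[normal_prob 0 1]_z (F z)%:E <= b%:E)%E -> ebound (gaussp R) F b.
Proof.
move=> F0 mF Fb Y k Q eta tau tau0 kQ /=; split.
  by apply: integral_ge0 => z _; case: (kQ z).
rewrite opprD addrA; apply: (@integral_ge_sub _ _ (fun z => tau * F z)).
- by move=> z; case: (kQ z).
- by move=> z; rewrite mulr_ge0.
- exact: measurable_funM.
- by move=> z; case: (kQ z) => _; rewrite opprD addrA.
under eq_integral do rewrite EFinM.
rewrite ge0_integralZl_EFin//; last 2 first.
- by move=> z _; rewrite lee_fin.
- exact/measurable_EFinP.
by rewrite EFinM lee_wpmul2l// lee_fin.
Qed.

Lemma measurable_gaussian_kernel (u w t : R) :
  measurable_fun setT (fun z : R => expR (- (u + w * z) ^+ 2 / (2 * t))).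
Proof.
apply: measurableT_comp => //=; apply: measurable_funM => //=.
apply: measurableT_comp => //=; apply: measurable_funX => //=.
apply: measurable_funD => //; exact: measurable_funM.
Qed.

Lemma integral_normal_mix_le (a c e u w t : R) : 0 <= a -> 0 <= c -> 0 <= e -> 0 < t ->
  (\int[normal_prob 0 1]_z
     (a * expR (- (u + w * z) ^+ 2 / (2 * t)) + (c + e * z ^+ 2))%:E <=
   (a * (Num.sqrt (t / (t + w ^+ 2)) * expR (- u ^+ 2 / (2 * (t + w ^+ 2)))) +
    (c + e * 6))%:E)%E.
Proof.
move=> a0 c0 e0 t0.
have m1 := measurable_gaussian_kernel u w t.
have m2 : measurable_fun setT (fun z : R => z ^+ 2) by exact: measurable_funX.
under eq_integral do rewrite EFinD [(c + _)%:E]EFinD 2![(_ * _)%:E]EFinM.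
rewrite ge0_integralD//=; last 4 first.
- by move=> z _; rewrite lee_fin mulr_ge0// expR_ge0.
- by apply/measurable_EFinP; exact: measurable_funM.
- by move=> z _; rewrite lee_fin addr_ge0// mulr_ge0// sqr_ge0.
- by apply/measurable_EFinP; apply: measurable_funD => //; exact: measurable_funM.
rewrite ge0_integralD//=; last 2 first.
- by move=> z _; rewrite lee_fin mulr_ge0// sqr_ge0.
- by apply/measurable_EFinP; exact: measurable_funM.
rewrite ge0_integralZl_EFin//=; last by apply/measurable_EFinP.
rewrite ge0_integralZl_EFin//=; last 2 first.
- by move=> z _; rewrite lee_fin sqr_ge0.
- by apply/measurable_EFinP.
have -> : (\int[normal_prob (0 : R) 1]__ c%:E = c%:E)%E.
  by rewrite integral_cst// [X in (_ * X)%E]probability_setT mule1.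
rewrite integral_normal_gaussian//.
rewrite !EFinD [(a * _)%:E]EFinM [(e * _)%:E]EFinM.
apply: leeD2l; apply: leeD2l; rewrite lee_wpmul2l ?lee_fin//.
exact: integral_normal_sqr_le.
Qed.

Variables (d : nat) (v : 'cV[R]_d) (a e : R).
Hypotheses (a0 : 0 <= a) (e0 : 0 <= e).

Local Notation pot t :=
  (fun x => a * expR (- mxform 1%:M v x ^+ 2 / (2 * t)) + e * norm2 x ^+ 2).

(* The Gaussian kernel exp (- <v, x>^2 / 2t) is stable under integrating out a
   coordinate of x: only its variance grows, by the square of that entry of v. *)
Lemma ebound_gauss_entries (s : seq 'I_d) (x : 'cV[R]_d) (t : R) : 0 < t -> uniq s ->
  (forall j, j \in s -> x j 0 = 0) ->
  ebound (update_entries s (fun _ _ => gaussp R) x) (pot t)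
    (a * (Num.sqrt (t / (t + \sum_(j <- s) v j 0 ^+ 2)) *
          expR (- mxform 1%:M v x ^+ 2 / (2 * (t + \sum_(j <- s) v j 0 ^+ 2))))
     + (e * norm2 x ^+ 2 + e * 6 * (size s)%:R)).
Proof.
move=> t0; elim: s x => [|j s IH] x us x0.
  apply: ebound_ret; rewrite big_nil addr0 divff ?gt_eqF// sqrtr1 mul1r.
  by rewrite mulr0 addr0.
move: us => /= /andP[js us].
set W := \sum_(i <- s) v i 0 ^+ 2.
have W0 : 0 <= W by apply: sumr_ge0 => i _; exact: sqr_ge0.
set u := mxform 1%:M v x.
have setu z : mxform 1%:M v (set_entry x j z) = u + v j 0 * z.
  rewrite /u !form1E (bigD1 j)//= [in RHS](bigD1 j)//= !mxE eqxx x0 ?mem_head// mulr0 add0r.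
  rewrite addrC; congr (_ + _); apply: eq_bigr => i ij.
  by rewrite mxE (negbTE ij).
have setn z : norm2 (set_entry x j z) ^+ 2 = norm2 x ^+ 2 + z ^+ 2.
  rewrite !sqr_norm2 (bigD1 j)//= [in RHS](bigD1 j)//= !mxE eqxx.
  rewrite x0 ?mem_head// expr0n add0r.
  rewrite addrC; congr (_ + _); apply: eq_bigr => i ij.
  by rewrite mxE (negbTE ij).
pose G z := a * Num.sqrt (t / (t + W)) * expR (- (u + v j 0 * z) ^+ 2 / (2 * (t + W)))
   + ((e * norm2 x ^+ 2 + e * 6 * (size s)%:R) + e * z ^+ 2).
have aq : 0 <= a * Num.sqrt (t / (t + W)) by rewrite mulr_ge0 ?sqrtr_ge0.
have cq : 0 <= e * norm2 x ^+ 2 + e * 6 * (size s)%:R.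
  by apply: addr_ge0; [rewrite mulr_ge0 ?sqr_ge0|rewrite !mulr_ge0].
have tW : 0 < t + W by lra.
have h1 := integral_normal_mix_le u (v j 0) aq cq e0 tW.
apply: (@ebound_bind _ _ _ (gaussp R)
  (fun z => update_entries s (fun _ _ => gaussp R) (set_entry x j z)) _ G).
  apply: ebound_gauss.
  - move=> z; rewrite /G; apply: addr_ge0; first by rewrite mulr_ge0 ?expR_ge0.
    by rewrite addr_ge0// mulr_ge0 ?sqr_ge0.
  - apply: measurable_funD.
      by apply: measurable_funM => //; exact: measurable_gaussian_kernel.
    have m2 : measurable_fun setT (fun z : R => z ^+ 2) by exact: measurable_funX.
    have m3 : measurable_fun setT (fun z : R => e * z ^+ 2) by exact: measurable_funM.
    exact: measurable_funD.
  apply: le_trans h1 _; rewrite lee_fin big_cons -/W.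
  rewrite [v j 0 ^+ 2 + W]addrC [t + (W + _)]addrA.
  have tWv : 0 < t + W + v j 0 ^+ 2 by have := sqr_ge0 (v j 0); lra.
  (* The normalising factors of successive coordinates telescope. *)
  have -> : Num.sqrt (t / (t + W + v j 0 ^+ 2)) =
      Num.sqrt (t / (t + W)) * Num.sqrt ((t + W) / (t + W + v j 0 ^+ 2)).
    rewrite -sqrtrM; last by rewrite divr_ge0// ltW.
    by congr Num.sqrt; field; rewrite !gt_eqF.
  by rewrite -[(size s).+1%:R]natr1 le_eqVlt; apply/orP; left; apply/eqP; ring.
move=> z; have := IH (set_entry x j z) us; rewrite setu setn.
have -> : a * (Num.sqrt (t / (t + W)) * expR (- (u + v j 0 * z) ^+ 2 / (2 * (t + W)))) +
   (e * (norm2 x ^+ 2 + z ^+ 2) + e * 6 * (size s)%:R) = G z by rewrite /G; ring.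
apply=> i si; rewrite mxE; case: eqVneq => [ij|_]; first by rewrite ij (negbTE js) in si.
by rewrite x0// in_cons si orbT.
Qed.

(** Since [v] is a unit vector, the kernel has mean sqrt (c^2 / (c^2 + 1)) <= c, a small-ball
    estimate for <v, x>. *)
Lemma ebound_gauss_vec (c : R) : 0 < c -> norm2 v = 1 ->
  ebound (gauss_vec R d) (pot (c ^+ 2)) (a * c + e * 6 * d%:R).
Proof.
move=> c0 v1; have c20 : 0 < c ^+ 2 by rewrite exprn_gt0.
apply: ebound_le (ebound_gauss_entries c20 (enum_uniq _) _); last first.
  by move=> j _; rewrite mxE.
rewrite size_enum_ord big_enum /= -sqr_norm2 v1 expr1n.
have n0 : norm2 (0 : 'cV[R]_d) = 0 by apply/eqP; rewrite norm2_eq0.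
have -> : mxform 1%:M v 0 = 0 by rewrite -(scale0r v) formZr mul0r.
rewrite n0 !expr0n /= oppr0 mul0r expR0 mulr1 mulr0 add0r lerD2r ler_wpM2l//.
rewrite -[leRHS]gtr0_norm// -sqrtr_sqr ler_wsqrtr// ler_pdivrMr; last by lra.
by rewrite mulrDr mulr1 lerDr mulr_ge0// ltW.
Qed.

End gaussian_start.

(** * Preprocessing, unit output and running time of the algorithm *)

Section algorithm.
Variable R : realType.

Lemma nat_ceil_ge (a : R) : 0 <= a -> a <= (nat_ceil a)%:R.
Proof.
move=> a0; have c0 : 0 <= Num.ceil a by rewrite -(ler_int R); apply: le_trans (ceil_ge a).
by rewrite /nat_ceil natr_absz ger0_norm// ceil_ge.
Qed.

Lemma nat_ceil_le (a : R) : 0 <= a -> (nat_ceil a)%:R <= a + 1.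
Proof.
move=> a0; have c0 : 0 <= Num.ceil a by rewrite -(ler_int R); apply: le_trans (ceil_ge a).
rewrite /nat_ceil natr_absz ger0_norm//.
by have := ltW (ceilB1_lt a); rewrite intrB lerBlDr.
Qed.

(** Lets the deterministic preamble be evaluated once for all three semantics, at the price of [N]
    instructions. *)
Definition reduces (X : Type) (c c' : prog R X) (N : nat) : Prop :=
  [/\ forall Q, prob c Q = prob c' Q, forall Q, always c' Q -> always c Q
    & forall m, time_le c' m -> time_le c (N + m)].

Lemma reduces_refl (X : Type) (c : prog R X) : reduces c c 0.
Proof. by split. Qed.

Lemma reduces_bind (X Y : Type) (c : prog R X) (f : X -> prog R Y) c' x N M :
  runs c x N -> reduces (f x) c' M -> reduces (bind c f) c' (N + M).
Proof.
move=> cx [h1 h2 h3]; split.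
- by move=> Q; rewrite (runs_prob _ _ cx).
- by move=> Q /h2; exact: (runs_always cx).
- by move=> m /h3; rewrite -addnA; exact: (runs_time_bind cx).
Qed.

Lemma always_bind_inv (X Y : Type) (c : prog R X) (f : X -> prog R Y) P Q :
  always c P -> (forall x, P x -> always (f x) Q) -> always (bind c f) Q.
Proof.
move=> + h; elim: c => [x|bop a b k IH|a k IH|a k IH|a k IH|m p k IH|k IH] /=.
- exact: h.
1-4: exact: IH.
all: by move=> H i; apply: IH.
Qed.

Lemma always_repeatp (X : Type) k (body : X -> prog R X) x Q :
  (forall x, always (body x) Q) -> Q x -> always (repeatp k body x) Q.
Proof.
move=> h; elim: k x => [|k IH] x Qx //=.
exact: always_bind_inv (h x) IH.
Qed.

Variables (n d : nat) (A : 'M[R]_(n, d)) (l1 l : R).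

Definition row_prob : 'cV[R]_n :=
  \col_i (mxform 1%:M (row i A)^T (row i A)^T / frobenius_norm A ^+ 2).

Local Notation S := (2 * (frobenius_norm A ^+ 2 * l1) / (l - l1)).
Local Notation M := (nat_ceil (64 * S / (l - l1))).
Local Notation iteration K :=
  (fun x => y <-- svrg_solve A l (1 / (8 * S)) M row_prob K x ;; normalizep y).

Let sqrow i :
  \sum_(j <- row_support A i) A i j * A i j = mxform 1%:M (row i A)^T (row i A)^T.
Proof.
rewrite sum_row_support; last by move=> j ->; rewrite mul0r.
by rewrite form1E; apply: eq_bigr => j _; rewrite !mxE.
Qed.

Lemma reduces_shift_invert_power T K :
  reduces (shift_invert_power A l1 l T K)
    (x0 <-- gauss_vec R d ;; x <-- normalizep x0 ;; repeatp T (iteration K) x)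
    (4 * nnz A + 9).
Proof.
pose q : 'cV[R]_n := \col_i mxform 1%:M (row i A)^T (row i A)^T.
have row0 i : i \notin nz_rows A -> mxform 1%:M (row i A)^T (row i A)^T = 0.
  by rewrite mem_enum inE negbK => /eqP ->; apply/eqP; rewrite form1_eq0 trmx0.
have Hq : runs (update_entries (nz_rows A)
   (fun i _ => sum_over (row_support A i) (fun j => mulp (A i j) (A i j))) 0) q (2 * nnz A).
  have h i (y : R) : runs (sum_over (row_support A i) (fun j => mulp (A i j) (A i j)))
      (mxform 1%:M (row i A)^T (row i A)^T) (2 * size (row_support A i)).
    have := @runs_sum_over _ _ (row_support A i) (fun j => mulp (A i j) (A i j))
      (fun j => A i j * A i j) (fun=> 1%N) (fun j => conj erefl erefl).
    by rewrite sqrow sum_nat_seq_const mulnC.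
  have := runs_update_entries 0 (enum_uniq [pred i | row i A != 0]) h.
  rewrite -big_distrr /= sum_size_row_support; congr (runs _ _ _).
  by apply/colP => i; rewrite !mxE; case: ifPn => // /row0.
have HF : runs (sum_over (nz_rows A) (fun i => Ret (q i 0)))
    (frobenius_norm A ^+ 2) (nnz A).
  apply: runs_leq (size_nz_rows A) _.
  have := @runs_sum_over R _ (nz_rows A) (fun i => Ret (q i 0)) (fun i => q i 0)
    (fun=> 0%N) (fun j => erefl).
  rewrite sum1_size; congr (runs _ _ _).
  rewrite sqr_frobenius_norm sum_nz_rows; first by apply: eq_bigr => i _; rewrite mxE.
  by move=> i ri; rewrite mxE ri; apply/eqP; rewrite form1_eq0 trmx0.
pose F2 := frobenius_norm A ^+ 2.
have Hp : runs (update_entries (nz_rows A) (fun _ y => Defs.divp y F2) q) row_prob (nnz A).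
  apply: runs_leq (size_nz_rows A) _.
  have := @runs_update_entries R _ (nz_rows A) (fun _ y => Defs.divp y F2)
    (fun _ y => y / F2) (fun=> 1%N) q (enum_uniq _) (fun j y => conj erefl erefl).
  rewrite sum1_size; congr (runs _ _ _).
  by apply/colP => i; rewrite !mxE; case: ifPn => // /row0 ->; rewrite mul0r.
(* Squared row norms cost 2 nnz, their sum and the normalisation at most nnz each, and nine scalar
   instructions follow. *)
have -> : (4 * nnz A + 9 = 2 * nnz A + (nnz A + (nnz A +
    (1 + (1 + (1 + (1 + (1 + (1 + (1 + (1 + (1 + 0))))))))))))%N by lia.
rewrite /shift_invert_power.
apply: reduces_bind Hq _; apply: reduces_bind HF _; apply: reduces_bind Hp _.
apply: (@reduces_bind _ _ _ _ _ (l - l1)); first by [].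
apply: (@reduces_bind _ _ _ _ _ (frobenius_norm A ^+ 2 * l1)); first by [].
apply: (@reduces_bind _ _ _ _ _ (2 * (frobenius_norm A ^+ 2 * l1))); first by [].
apply: (@reduces_bind _ _ _ _ _ S); first by [].
apply: (@reduces_bind _ _ _ _ _ (8 * S)); first by [].
apply: (@reduces_bind _ _ _ _ _ (1 / (8 * S))); first by [].
apply: (@reduces_bind _ _ _ _ _ (64 * S)); first by [].
apply: (@reduces_bind _ _ _ _ _ (64 * S / (l - l1))); first by [].
apply: (@reduces_bind _ _ _ _ _ M); first by [].
exact: reduces_refl.
Qed.

Lemma time_le_gauss_vec : time_le (gauss_vec R d) d.
Proof.
have h : time_le (gauss_vec R d) (size (enum 'I_d) * 1).
  by apply: time_le_foreach => j x; split.
by rewrite size_enum_ord muln1 in h.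
Qed.

Lemma time_le_svrg_epoch eta (m : nat) (p : 'cV[R]_n) (b x0 : 'cV[R]_d) :
  time_le (svrg_epoch A l eta m p b x0) (2 * d + 4 * nnz A + (1 + (1 + m * (19 * d + 4)))).
Proof.
apply: runs_time_bind (runs_grad_f _ _ _ _) _.
apply: (@runs_time_bind _ _ _ _ _ (1 / m%:R)) => //.
apply: time_le_bind => //.
move=> k; have -> : (19 * d + 4 = 1 + (19 * d + 3))%N by lia.
(* The drawn index is below [m], so at most [m] steps are made. *)
apply: (@time_leS _ _ _ (k.+1 * (1 + (19 * d + 3)))).
  by rewrite leq_mul2r ltn_ord orbT.
apply: time_le_repeatp => x; apply: time_le_bind => // i.
exact: runs_time (runs_svrg_step_tail _ _ _ _ _ _ _ _ _).
Qed.

Lemma time_le_iteration K x : time_le (iteration K x)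
  (K * (2 * d + 4 * nnz A + (1 + (1 + M * (19 * d + 4)))) + (3 * d + 2)).
Proof.
apply: time_le_bind; last by move=> y; exact: runs_time (runs_normalizep y).
by apply: time_le_repeatp => y; exact: time_le_svrg_epoch.
Qed.

Definition total_time T K : nat :=
  4 * nnz A + 9 + (d + (3 * d + 2 +
    T * (K * (2 * d + 4 * nnz A + (1 + (1 + M * (19 * d + 4)))) + (3 * d + 2)))).

Lemma time_le_shift_invert_power T K :
  time_le (shift_invert_power A l1 l T K) (total_time T K).
Proof.
have [_ _] := reduces_shift_invert_power T K; apply.
apply: time_le_bind time_le_gauss_vec _ => x0.
apply: runs_time_bind (runs_normalizep x0) _.
apply: time_le_repeatp => x; exact: time_le_iteration.
Qed.

Lemma always_unit_shift_invert_power T K : (0 < d)%N ->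
  always (shift_invert_power A l1 l T K) [set x | norm2 x = 1].
Proof.
move=> d0; have [_ h _] := reduces_shift_invert_power T K; apply: h.
apply: always_bind => x0; apply: runs_always (runs_normalizep x0) _.
apply: always_repeatp; last exact: norm2_unitv.
move=> x; apply: always_bind => y.
have -> : normalizep y = bind (normalizep y) Ret by rewrite bind_ret.
by apply: runs_always (runs_normalizep y) _; exact: norm2_unitv.
Qed.

End algorithm.

(** * Numerical estimates for the iteration counts *)

Section numbers.
Variable R : realType.

(** From 1/2 <= exp (-1/2). It converts ceilings of multiples of ln D into powers of D, through 4^T
    >= e^T and 2^K >= e^(K/2). *)
Lemma expR_half_le2 : expR (1 / 2 : R) <= 2.
Proof.
have h := expR_ge1Dx (- (1 / 2) : R).
have e0 := expR_gt0 (1 / 2 : R).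
have e1 := expRxMexpNx_1 (1 / 2 : R).
have : expR (1 / 2) * (1 + - (1 / 2)) <= expR (1 / 2) * expR (- (1 / 2)) :> R.
  by rewrite ler_pM2l.
by rewrite e1; lra.
Qed.

Lemma expR_half_nat_le k : expR (k%:R / 2 : R) <= 2 ^+ k.
Proof.
have -> : k%:R / 2 = k%:R * (1 / 2) :> R by field.
rewrite expRM_natl lerXn2r ?nnegrE ?expR_ge0//; exact: expR_half_le2.
Qed.

Lemma expR_nat_le k : expR (k%:R : R) <= 4 ^+ k.
Proof.
have := expR_half_nat_le (k * 2).
by rewrite mulnC exprM -natrX natrM mulrC mulKf.
Qed.

Lemma expR_ln_natM k (D : R) : 0 < D -> expR (k%:R * ln D) = D ^+ k.
Proof. by move=> D0; rewrite expRM_natl lnK. Qed.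

Lemma ln_le_self (D : R) : 0 < D -> ln D <= D.
Proof. by move=> D0; have := expR_ge1Dx (ln D); rewrite lnK ?posrE//; lra. Qed.

Lemma ln_ge_half (D : R) : 2 <= D -> 1 / 2 <= ln D.
Proof.
move=> D2; have D0 : 0 < D by lra.
rewrite -[leLHS]expRK ler_ln ?posrE ?expR_gt0//.
by apply: le_trans D2; exact: expR_half_le2.
Qed.

(** Here q stands for sr / eps^2, L for ln D, and m, t, k for M, T, K. Lower-order terms are
    absorbed using X >= 1 and L >= 1/2, which give X <= 4 X L^2 and L X <= 2 X L^2. *)
Lemma time_budget (c L q dd nz m t k : R) :
  0 <= c -> 1 / 2 <= L -> 1 <= q -> 1 <= dd -> 0 <= nz -> 0 <= m -> 0 <= t -> 0 <= k ->
  m <= (c + 1) * q -> t <= 23 * L -> k <= 162 * L ->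
  4 * nz + 9 + (dd + (3 * dd + 2 +
    t * (k * (2 * dd + 4 * nz + (1 + (1 + m * (19 * dd + 4)))) + (3 * dd + 2)))) <=
  (76 + 230 + 23 * 162 * (8 + 23 * (c + 1))) * ((nz + dd * q) * L ^+ 2).
Proof.
move=> c0 L2 q1 dd1 nz0 m0 t0 k0 hm ht hk.
have dq : dd <= dd * q by rewrite ler_peMr//; lra.
set X := nz + dd * q.
have X1 : 1 <= X by rewrite /X; lra.
have mX : m * dd <= (c + 1) * X.
  apply: (@le_trans _ _ ((c + 1) * (dd * q))); last by rewrite ler_wpM2l// /X; lra.
  by rewrite mulrCA [dd * _]mulrC ler_pM2r//; lra.
pose I := 2 * dd + 4 * nz + (1 + (1 + m * (19 * dd + 4))).
set Z := 8 + 23 * (c + 1); rewrite -/I.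
have inner : I <= Z * X.
  have : m <= m * dd by rewrite ler_peMr.
  by rewrite /I /Z /X in mX *; lra.
have I0 : 0 <= I.
  by have : 0 <= m * (19 * dd + 4) by [rewrite mulr_ge0//; lra]; rewrite /I; lra.
have kI : k * I <= 162 * L * (Z * X) by apply: ler_pM.
have tkI : t * (k * I) <= 23 * L * (162 * L * (Z * X)).
  by apply: ler_pM => //; rewrite mulr_ge0.
have tN : t * (3 * dd + 2) <= 23 * L * (5 * X).
  by apply: ler_pM => //; rewrite /X; lra.
have LX : L * X <= 2 * (X * L ^+ 2).
  have : 0 <= X * L * (2 * L - 1) by rewrite !mulr_ge0//; lra.
  lra.
have XL : X <= 4 * (X * L ^+ 2).
  have : 0 <= X * (2 * L - 1) by rewrite mulr_ge0//; lra.
  lra.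
have -> : (76 + 230 + 23 * 162 * Z) * (X * L ^+ 2) =
    76 * (X * L ^+ 2) + 115 * (2 * (X * L ^+ 2)) + 23 * L * (162 * L * (Z * X)) by ring.
have : 4 * nz + 9 + (dd + (3 * dd + 2)) <= 19 * X by rewrite /X; lra.
move: (t * (k * I)) (t * (3 * dd + 2)) tkI tN (mulrDr t (k * I) (3 * dd + 2)).
move=> a1 a2 h1 h2 ->; lra.
Qed.

Variable D : R.
Hypothesis D2 : 2 <= D.
Let D0 : 0 < D. Proof. exact: lt_le_trans D2. Qed.
Let L0 : 0 < ln D. Proof. by have := ln_ge_half D2; lra. Qed.

Let pow2_le k : 2 ^+ k <= D ^+ k.
Proof. by rewrite lerXn2r ?nnegrE// ltW. Qed.

Let T := nat_ceil (21 * ln D).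
Let K := nat_ceil (160 * ln D).

Lemma power_count_gt0 : (0 < T)%N.
Proof.
rewrite -(ltr0n R); apply: lt_le_trans (nat_ceil_ge _); last first.
  by apply: mulr_ge0 => //; exact: ltW.
exact: mulr_gt0.
Qed.

(** The multiplier 21 just exceeds the exponent 20 of Psi, giving strict inequality. *)
Lemma power_count_large : D ^+ 20 < 4 ^+ T.
Proof.
apply: lt_le_trans (expR_nat_le T); rewrite -(expR_ln_natM _ D0) ltr_expR.
apply: lt_le_trans (nat_ceil_ge _); last by apply: mulr_ge0 => //; exact: ltW.
by rewrite ltr_pM2r// ltr_nat.
Qed.

Let T_le : T%:R <= D ^+ 6.
Proof.
have h : T%:R <= 21 * ln D + 1 by apply: nat_ceil_le; apply: mulr_ge0 => //; exact: ltW.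
have := ln_le_self D0; have := pow2_le 5.
have -> : D ^+ 6 = D ^+ 5 * D by rewrite exprSr.
have -> : 2 ^+ 5 = 32 :> R by rewrite -natrX.
move: (D ^+ 5) => E e1 e2.
have : 32 * D <= E * D by rewrite ler_pM2r.
have := D2; lra.
Qed.

Let K_ge : D ^+ 80 <= 2 ^+ K.
Proof.
apply: le_trans (expR_half_nat_le K); rewrite -(expR_ln_natM _ D0) ler_expR.
have : 160 * ln D <= K%:R by apply: nat_ceil_ge; apply: mulr_ge0 => //; exact: ltW.
have : (160 : R) = 2 * 80 by rewrite -natrM.
move=> ->; move: (80 : R) => q; lra.
Qed.

(** With 24 <= D^5, T <= D^6 and 2^K >= D^80, the left side is at most D^(6 - 80 + 62) = D^-12; the
    multiplier 160 is chosen for this. *)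
Lemma failure_small :
  T%:R * ((1 / 2) ^+ K * (24 * T%:R * D ^+ 20) ^+ 2) <= D ^- 10.
Proof.
have e1 := pow2_le 5; have E32 : 2 ^+ 5 = 32 :> R by rewrite -natrX.
rewrite E32 in e1.
have T0 : 0 <= T%:R :> R by exact: ler0n.
have Dk k : 0 < D ^+ k by exact: exprn_gt0.
have h1 : 24 * T%:R * D ^+ 20 <= D ^+ 31.
  have -> : D ^+ 31 = D ^+ 5 * D ^+ 6 * D ^+ 20 by rewrite -!exprD.
  rewrite ler_pM2r//; apply: ler_pM => //; lra.
have h2 : (24 * T%:R * D ^+ 20) ^+ 2 <= D ^+ 62.
  have -> : D ^+ 62 = (D ^+ 31) ^+ 2 by rewrite -exprM.
  rewrite lerXn2r ?nnegrE ?(ltW (Dk _))//.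
  by apply: mulr_ge0 (ltW (Dk _)); apply: mulr_ge0.
have h3 : (1 / 2) ^+ K <= D ^- 80 :> R.
  by rewrite div1r exprVn lef_pV2 ?posrE ?exprn_gt0.
have h4 : (1 / 2) ^+ K * (24 * T%:R * D ^+ 20) ^+ 2 <= D ^- 80 * D ^+ 62.
  by apply: ler_pM => //; rewrite ?sqr_ge0 ?exprn_ge0 ?divr_ge0.
apply: (@le_trans _ _ (D ^+ 6 * (D ^- 80 * D ^+ 62))).
  by apply: ler_pM => //; rewrite mulr_ge0 ?sqr_ge0 ?exprn_ge0 ?divr_ge0.
rewrite mulrCA -exprD mulrC ler_pdivrMr// ler_pdivlMl// -exprD.
by apply: ler_weXn2l => //; apply: le_trans D2; rewrite ler1n.
Qed.

End numbers.

(** * Assembly of the probability and time bounds *)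

Section main.
Variables (R : realType) (n d : nat) (A : 'M[R]_(n, d)) (eps l1 : R).
Hypotheses (A0 : A != 0) (eps0 : 0 < eps) (eps1 : eps < 1).
Hypothesis hl1 : largest_eigenvalue (A^T *m A) l1.
Local Notation l := ((1 + eps / 100) * l1).
Local Notation D := (d%:R / eps).
Local Notation T := (nat_ceil (21 * ln D)).
Local Notation K := (nat_ceil (160 * ln D)).
Local Notation S := (2 * (frobenius_norm A ^+ 2 * l1) / (l - l1)).
Local Notation iteration K :=
  (fun x => y <-- svrg_solve A l (1 / (8 * S)) (nat_ceil (64 * S / (l - l1)))
                    (row_prob A) K x ;; normalizep y).

Let l10 : 0 < l1. Proof. exact: largest_eigenvalue_gt0 hl1. Qed.
Let d0 : (0 < d)%N. Proof. exact: nonzero_dim A0. Qed.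
Let d1 : 1 <= d%:R :> R. Proof. by rewrite ler1n. Qed.
Let muE : l - l1 = eps / 100 * l1. Proof. ring. Qed.
Let mu0 : 0 < l - l1. Proof. by rewrite muE mulr_gt0// divr_gt0. Qed.
Let l1l : l1 < l. Proof. by rewrite -subr_gt0. Qed.

Let hlm : l * (l - l1) <= frobenius_norm A ^+ 2 * l1.
Proof.
rewrite muE mulrA ler_pM2r//; apply: le_trans (largest_eigenvalue_le_frobenius hl1).
rewrite -[leRHS]mul1r mulrAC ler_pM2r//.
have e0 := eps0; have e1 := eps1; nra.
Qed.

Let r0 : 0 <= 64 * S / (l - l1).
Proof.
apply: divr_ge0 (ltW mu0); apply: mulr_ge0 => //; apply: divr_ge0 (ltW mu0).
by apply: mulr_ge0 => //; apply: mulr_ge0 (ltW l10); exact: sqr_ge0.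
Qed.

Let hM := nat_ceil_ge r0.
Let hp i : row_prob A i 0 = mxform 1%:M (row i A)^T (row i A)^T / frobenius_norm A ^+ 2.
Proof. by rewrite mxE. Qed.

(** Not automatic, since [Draw] accepts arbitrary real weights. It follows from the mass-preserving
    bound with eta = 1 and tau = 0. *)
Lemma prob_shift_invert_power_ge0 T' K' Q :
  (0 <= prob (shift_invert_power A l1 l T' K') Q)%E.
Proof.
have [-> _ _] := reduces_shift_invert_power A l1 l T' K'.
have [v hv v1] := top_eigenvector hl1.
have H : ebound (x0 <-- gauss_vec R d ;; x <-- normalizep x0 ;;
    repeatp T' (iteration K') x)
  (fun=> 0) 0.
  apply: (@ebound_bind _ _ _ _ _ _ (fun=> 0)).
    have := ebound_gauss_vec (lexx 0) (lexx 0) ltr01 v1.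
    rewrite !mul0r addr0; apply: ebound_mono => x; by rewrite !mul0r addr0.
  move=> x0; apply: ebound_runs (runs_normalizep x0) _.
  exact: (ebound_power_loop_triv A0 hl1 l1l hlm hp hM K').
rewrite -(bind_ret (bind _ _)).
apply: (H _ Ret Q 1 0 (lexx 0) _).1 => x /=.
by rewrite mul0r addr0 subrr lee_fin indicE ler0n.
Qed.

Lemma prob_shift_invert_power : (1 < d)%N ->
  ((1 - 9 / d%:R ^+ 10)%:E <=
     prob (shift_invert_power A l1 l T K)
       [set x | ((1 - eps) * l1 <= quad_form (A^T *m A) x)%R])%E.
Proof.
move=> d2; have e0 := eps0; have e1 := eps1.
have [-> _ _] := reduces_shift_invert_power A l1 l T K.
have [v hv v1] := top_eigenvector hl1.
have d2' : 2 <= d%:R :> R by rewrite ler_nat.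
have d0' : 0 < d%:R :> R by lra.
have dD : d%:R <= D by rewrite ler_pdivlMr// ler_piMr// ltW.
have D2 : 2 <= D by lra.
have D0 : 0 < D by lra.
have dk k : 0 < d%:R ^+ k :> R by rewrite exprn_gt0.
have T0 := power_count_gt0 D2.
set Psi := D ^+ 20.
have P1 : 1 <= Psi by rewrite exprn_ege1//; lra.
(* The start is good if |<v, x0>| >= c and |x0|^2 <= s. These choices make both failure terms, 2 c
   and 6 d / s = 6 c, of order d^-10. *)
pose c : R := d%:R ^- 10.
have c0 : 0 < c by rewrite invr_gt0.
pose s : R := d%:R ^+ 11.
have s0 : 0 < s by exact: (dk 11%N).
pose bad (x : 'cV[R]_d) : R := (~~ `[< power_inv A l1 l v Psi T T x >])%:R.
pose err : R := (1 / 2) ^+ K * (24 * T%:R * Psi) ^+ 2.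
have err0 : 0 <= err by rewrite mulr_ge0 ?sqr_ge0// exprn_ge0// divr_ge0.
(* Here s = d^31 c^2 and Psi^2 mu = D^39 d l1 / 100; the claim follows from D^30 >= d^30 and D^9 >=
   2^9 > 101. This fixes the exponent 20 in Psi. *)
have init : l * s <= Psi ^+ 2 * (l - l1) * c ^+ 2.
  have sE : s = d%:R ^+ 31 * c ^+ 2.
    rewrite /c exprVn -exprM (_ : 31 = 11 + 10 * 2)%N// exprD mulfK//.
    by rewrite gt_eqF.
  rewrite sE mulrA ler_pM2r ?exprn_gt0// muE.
  have -> : Psi ^+ 2 * (eps / 100 * l1) = (D ^+ 9 * D ^+ 30 * d%:R) / 100 * l1.
    rewrite /Psi -exprM -exprD (_ : 20 * 2 = 39 + 1)%N// exprD expr1.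
    by field; rewrite gt_eqF.
  rewrite mulrAC ler_pM2r// ler_pdivlMr//.
  have -> : (1 + eps / 100) * d%:R ^+ 31 * 100 = (1 + eps / 100) * 100 * d%:R ^+ 30 * d%:R.
    by rewrite [d%:R ^+ 31]exprSr; ring.
  rewrite ler_pM2r//.
  have h30 : d%:R ^+ 30 <= D ^+ 30 by rewrite lerXn2r ?nnegrE//; lra.
  have h9 : 101 <= D ^+ 9.
    have : 2 ^+ 9 <= D ^+ 9 by rewrite lerXn2r ?nnegrE//; lra.
    by apply: le_trans; rewrite -natrX ler_nat.
  apply: ler_pM => //; [by apply: mulr_ge0 => //; lra|lra].
have si : 0 <= s^-1 by rewrite invr_ge0 ltW.
have Hg := @ebound_gauss_vec R d v 2 s^-1 (ler0n _ 2) si c c0 v1.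
pose G (x : 'cV[R]_d) := T%:R * err +
   1 * (2 * expR (- mxform 1%:M v x ^+ 2 / (2 * c ^+ 2)) + s^-1 * norm2 x ^+ 2).
have H : ebound (x0 <-- gauss_vec R d ;; x <-- normalizep x0 ;;
    repeatp T (iteration K) x)
  bad (T%:R * err + 1 * (2 * c + s^-1 * 6 * d%:R)).
  apply: (@ebound_bind _ _ _ _ _ _ G); first exact: ebound_affine Hg.
  move=> x0; apply: ebound_runs (runs_normalizep x0) _.
  have L1 : 0 <= 2 * expR (- mxform 1%:M v x0 ^+ 2 / (2 * c ^+ 2)).
    by rewrite mulr_ge0 ?expR_ge0.
  have L2 : 0 <= s^-1 * norm2 x0 ^+ 2 by rewrite mulr_ge0 ?sqr_ge0 ?invr_ge0 ?ltW.
  have Te : 0 <= T%:R * err by rewrite mulr_ge0.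
  have [good|/not_andP ngood] := pselect (c <= `|mxform 1%:M v x0| /\ norm2 x0 ^+ 2 <= s).
    have Inv : power_inv A l1 l v Psi T 0 (unitv x0).
      by apply: (power_inv_init A0 hl1 l1l T _ c0 good.1 good.2 init); lra.
    have := ebound_power_loop A0 hl1 l1l hv v1 hlm hp hM K P1 (add0n T) Inv.
    by apply: ebound_le; rewrite /G -/err; lra.
  apply: (@ebound_le _ _ _ _ (1 + 0 * 0)).
    suff : 1 <= 2 * expR (- mxform 1%:M v x0 ^+ 2 / (2 * c ^+ 2)) + s^-1 * norm2 x0 ^+ 2.
      by rewrite /G; lra.
    (* If |<v, x0>| < c, the exponent is at least -1/2 and 1 + x <= exp x makes the doubled kernel
       at least 1; otherwise the norm term is. *)
    case: ngood => /negP; rewrite -ltNge => h.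
      have := expR_ge1Dx (- mxform 1%:M v x0 ^+ 2 / (2 * c ^+ 2)).
      have : mxform 1%:M v x0 ^+ 2 / (2 * c ^+ 2) <= 1 / 2.
        rewrite ler_pdivrMr; last by rewrite mulr_gt0// exprn_gt0.
        rewrite mulrA divfK// mul1r -(real_normK (num_real (mxform 1%:M v x0))).
        by rewrite lerXn2r ?nnegrE// ltW.
      rewrite mulNr; lra.
    have : 1 <= s^-1 * norm2 x0 ^+ 2 by rewrite ler_pdivlMl// mulr1 ltW.
    lra.
  apply: ebound_affine (ebound_power_loop_triv A0 hl1 l1l hlm hp hM K T _) => // x.
  by rewrite mulr0 addr0 /bad; case: asboolP.
apply: le_trans (ebound_prob _ _ H); last 2 first.
- by move=> x; rewrite /bad ler0n.
- move=> x nQ; rewrite /bad; case: asboolP => //= hx; exfalso; apply: nQ.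
  have := power_inv_final A0 hl1 l1l v1 (le_trans ler01 P1) (power_count_large D2) T0 hx.
  apply: le_trans; rewrite muE.
  have : 0 <= eps * l1 by rewrite mulr_ge0// ltW.
  lra.
rewrite lee_fin lerB//.
have Hf : T%:R * err <= c.
  apply: le_trans (failure_small D2) _; rewrite /c lef_pV2 ?posrE ?exprn_gt0//.
  by rewrite lerXn2r ?nnegrE//; lra.
have -> : s^-1 * 6 * d%:R = 6 * c.
  by rewrite /s /c exprS; field; rewrite !gt_eqF.
have -> : 9 / d%:R ^+ 10 = 9 * c by [].
lra.
Qed.

Lemma total_time_le : 2 <= D ->
  (total_time A l1 l T K)%:R <=
  (76 + 230 + 23 * 162 * (8 + 23 * (128 * 100 ^+ 2 + 1))) *
    (((nnz A)%:R + d%:R * stable_rank A / eps ^+ 2) * ln D ^+ 2) :> R.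
Proof.
move=> D2; have L2 := ln_ge_half D2.
have lnM k : 0 <= k%:R * ln D by rewrite mulr_ge0// (le_trans _ L2)// divr_ge0.
(* The extra 1 of the ceiling is at most 2 ln D. *)
have hT : T%:R <= 23 * ln D by have := nat_ceil_le (lnM 21); lra.
have hK : K%:R <= 162 * ln D by have := nat_ceil_le (lnM 160); lra.
have e2 : 0 < eps ^+ 2 by rewrite exprn_gt0.
have q1 : 1 <= stable_rank A / eps ^+ 2.
  rewrite ler_pdivlMr// mul1r; apply: le_trans (stable_rank_ge1 A0).
  by rewrite exprn_ile1// ltW.
have c0 : 0 <= 128 * 100 ^+ 2 :> R by rewrite mulr_ge0// exprn_ge0.
have hm : (nat_ceil (64 * S / (l - l1)))%:R <=
    (128 * 100 ^+ 2 + 1) * (stable_rank A / eps ^+ 2).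
  apply: le_trans (nat_ceil_le r0) _; rewrite [leRHS]mulrDl [X in _ <= _ + X]mul1r.
  apply: lerD => //.
  (* 128 = 64 * 2 comes from S, and 100^2 from the two divisions by mu = eps l1 / 100. *)
  have -> : 64 * S / (l - l1) = 128 * 100 ^+ 2 * (frobenius_norm A ^+ 2 / l1 / eps ^+ 2).
    by rewrite muE; field; rewrite !gt_eqF.
  rewrite ler_wpM2l// ler_pM2r ?invr_gt0//.
  exact: frobenius_div_le_stable_rank A0 hl1.
rewrite /total_time !(natrD, natrM) -[d%:R * _ / _]mulrA.
exact: time_budget.
Qed.

End main.

(** The time bound is guarded by 2 <= d / eps because for d = 1 and eps close to 1 the logarithm
    tends to 0 while the fixed costs remain. *)
Theorem theorem8p3 (R : realType) :
  exists cT cK C1 C2 : R,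
    [/\ 0 < cT, 0 < cK, 0 < C1 & 0 < C2] /\
    forall (n d : nat) (A : 'M[R]_(n, d)) (eps l1 : R),
      A != 0 ->
      0 < eps < 1 ->
      largest_eigenvalue (A^T *m A) l1 ->
      let l := (1 + eps / 100) * l1 in
      let T := nat_ceil (cT * ln (d%:R / eps)) in
      let K := nat_ceil (cK * ln (d%:R / eps)) in
      let alg := shift_invert_power A l1 l T K in
      [/\ always alg [set x | norm2 x = 1],
          ((1 - C1 / d%:R ^+ 10)%:E <=
             prob alg [set x | ((1 - eps) * l1 <= quad_form (A^T *m A) x)%R])%E
        & 2 <= d%:R / eps ->
          exists N : nat,
            time_le alg N /\
            N%:R <= C2 * (((nnz A)%:R + d%:R * stable_rank A / eps ^+ 2)
                            * ln (d%:R / eps) ^+ 2)].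
Proof.
exists 21, 160, 9, (76 + 230 + 23 * 162 * (8 + 23 * (128 * 100 ^+ 2 + 1))); split.
  split; [by rewrite ltr0n..|].
  do ?[apply: addr_gt0 | apply: mulr_gt0 | apply: exprn_gt0 |
       by rewrite ltr0n | exact: ltr01].
move=> n d A eps l1 A0 /andP[eps0 eps1] hl1 l T K alg; split.
- exact: always_unit_shift_invert_power (nonzero_dim A0).
(* For d = 1 the claimed lower bound is 1 - 9 < 0, so nonnegativity of the probability is enough. *)
- have [d2|d2] := ltnP 1 d; first exact: prob_shift_invert_power.
  apply: le_trans (prob_shift_invert_power_ge0 _ _ _ _ _ _ _) => //.
  have -> : d = 1%N by have := nonzero_dim A0; lia.
  by rewrite expr1n lee_fin; lra.
- move=> D2; exists (total_time A l1 l T K); split.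
    exact: time_le_shift_invert_power.
  exact: total_time_le.
Qed.
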